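(* Let $k\ge2$ be an integer and let $Z_1',\dots,Z_k'$ be i.i.d. random variables with the distribution $\mathscr{D}'$ (defined in the context). Assume that $f$ is a probability density function on $\mathbb{R}^d$ and $x_1,\dots,x_k$ are $k$ distinct Lebesgue points of $f$ such that $f(x_1),\dots,f(x_k)$ are all positive. Let $\mu_f$ be the measure with density $f$, let $X_1,\dots,X_n$ be i.i.d. with distribution $\mu_f$, and let $A_n'(x_1),\dots,A_n'(x_k)$ be the Voronoi cells with nuclei $x_1,\dots,x_k$, respectively, in the Voronoi diagram generated by $\{x_1,\dots,x_k,X_1,\dots,X_n\}$. Then, as $n\to\infty$, $$\left(n\mu_f(A_n'(x_1)),\dots,n\mu_f(A_n'(x_k))\right)\to(Z_1',\dots,Z_k')\quad\text{in distribution}.$$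
   Context: $d\ge1$ is an integer, $\|\cdot\|$ is the Euclidean norm on $\mathbb{R}^d$, $\lambda$ is Lebesgue measure, and $B_{z,r}$ is the open ball with center $z$ and radius $r$. A point $x\in\mathbb{R}^d$ is a Lebesgue point of $f$ if $\lim_{r\to0}\frac{1}{\lambda(B_{x,r})}\int_{B_{x,r}}|f(u)-f(x)|\,du=0$. Given a finite set $S\subset\mathbb{R}^d$ and $s\in S$, the Voronoi cell with nucleus $s$ in the Voronoi diagram generated by $S$ is $\{p\in\mathbb{R}^d:\ \|p-s\|\le\|p-s'\|\ \text{for all } s'\in S\setminus\{s\}\}$. Definition of $\mathscr{D}'$. For a probability density $g$ on $\mathbb{R}^d$ and a point $x$, let $A_n(x)$ be the Voronoi cell with nucleus $x$ in the Voronoi diagram generated by $\{x,X_1,\dots,X_n\}$, where $X_1,\dots,X_n$ are i.i.d. with distribution $\mu_g$ (the measure with density $g$). It is a known theorem of Devroye, Györfi, Lugosi and Walk (2017) that there is a probability distribution $\mathscr{D}'$, depending only on $d$, such that for every probability density $g$ on $\mathbb{R}^d$ and every Lebesgue point $x$ of $g$ with $g(x)>0$, $n\mu_g(A_n(x))$ converges in distribution to $\mathscr{D}'$ as $n\to\infty$. *)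

(* Defs.v *)
From HB Require Import structures.
From mathcomp Require Import all_boot all_order all_algebra.
From mathcomp Require Import finmap.
From mathcomp Require Import all_classical all_reals all_analysis.
From mathcomp Require Import measurable_realfun.

Set Implicit Arguments.
Unset Strict Implicit.
Unset Printing Implicit Defensive.

Import Order.TTheory GRing.Theory Num.Theory.
Import numFieldNormedType.Exports.

Local Open Scope classical_set_scope.
Local Open Scope ring_scope.

(* R^n is 'rV[R]_n with the sigma-algebra generated by the coordinates, which
   is its Borel sigma-algebra. *)
Definition measure_rV_display : measure_display.
Proof. exact: default_measure_display. Qed.

Section measurable_rV.
Context {R : realType} {n : nat}.

Let coord : 'I_n -> 'rV[R]_n -> R := fun i v => v ord0 i.

Let rV_set0 : g_sigma_preimage coord set0.
Proof. exact: sigma_algebra0. Qed.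

Let rV_setC A : g_sigma_preimage coord A -> g_sigma_preimage coord (~` A).
Proof. exact: sigma_algebraC. Qed.

Let rV_bigcup (F : (set 'rV[R]_n)^nat) :
  (forall i, g_sigma_preimage coord (F i)) ->
  g_sigma_preimage coord (\bigcup_i (F i)).
Proof. exact: sigma_algebra_bigcup. Qed.

HB.instance Definition _ := @isMeasurable.Build measure_rV_display
  'rV[R]_n (g_sigma_preimage coord) rV_set0 rV_setC rV_bigcup.

Lemma measurable_coord (i : 'I_n) :
  measurable_fun [set: 'rV[R]_n] (fun v => v ord0 i).
Proof.
move=> _ Y mY; rewrite setTI; apply: sub_sigma_algebra => /=.
rewrite -bigcup_seq/=; exists i => /=; first by rewrite mem_index_enum.
by exists Y => //; rewrite setTI.
Qed.

Lemma measurable_fun_rVP d (T : measurableType d) (f : T -> 'rV[R]_n) :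
  measurable_fun [set: T] f <->
  forall i, measurable_fun [set: T] (fun x => f x ord0 i).
Proof.
split=> [mf i|mf].
  exact: (measurableT_comp (measurable_coord i) mf).
suff H : @measurable _ 'rV[R]_n `<=` [set A | measurable (f @^-1` A)].
  by move=> _ A mA; rewrite setTI; exact: H.
apply: smallest_sub.
  split => /=; first by rewrite preimage_set0.
  - by move=> A mA; rewrite setTD preimage_setC; exact: measurableC.
  - by move=> F mF; rewrite preimage_bigcup; exact: bigcupT_measurable.
move=> A; rewrite -bigcup_seq => -[i _ /= [B mB <-]] /=.
rewrite setTI; have := mf i measurableT B mB.
by rewrite setTI.
Qed.

End measurable_rV.

Definition rVcons (R : realType) (n : nat) (p : R * 'rV[R]_n) : 'rV[R]_n.+1 :=
  row_mx p.1%:M p.2.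

(* Lebesgue measure on R^n: the n-fold product of Lebesgue measure on R. *)
Fixpoint lebesgue_rV {R : realType} {n : nat} : set 'rV[R]_n -> \bar R :=
  match n with
  | 0 => dirac (0 : 'rV[R]_0)
  | m.+1 => pushforward (lebesgue_measure \x @lebesgue_rV R m)%E (@rVcons R m)
  end.

Section lebesgue_rV_measure.
Context {R : realType}.

Lemma rVcons0 n (p : R * 'rV[R]_n) : rVcons p ord0 ord0 = p.1.
Proof.
have -> : ord0 = lshift n (ord0 : 'I_1) :> 'I_(1 + n) by exact/val_inj.
by apply: etrans (row_mxEl _ _ _ _) _; rewrite mxE.
Qed.

Lemma rVconsS n (p : R * 'rV[R]_n) i : rVcons p ord0 (lift ord0 i) = p.2 ord0 i.
Proof.
have -> : lift ord0 i = rshift 1 i :> 'I_(1 + n) by exact/val_inj.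
exact: row_mxEr.
Qed.

Lemma measurable_rVcons n :
  measurable_fun [set: measurableTypeR R * 'rV[R]_n] (@rVcons R n).
Proof.
apply/measurable_fun_rVP => i.
case: (unliftP ord0 i) => [j|] ->.
  under eq_fun do rewrite rVconsS.
  exact: (measurableT_comp (measurable_coord j)).
under eq_fun do rewrite rVcons0.
exact: measurable_fst.
Qed.

Lemma rVcons_surj n (v : 'rV[R]_n.+1) :
  v = rVcons (v ord0 ord0, \row_i v ord0 (lift ord0 i)).
Proof.
apply/rowP => i; case: (unliftP ord0 i) => [j|] ->.
  by rewrite rVconsS mxE.
by rewrite rVcons0.
Qed.

Lemma lebesgue_rV_ex n : exists mu : {sigma_finite_measure set 'rV[R]_n -> \bar R},
  @lebesgue_rV R n = mu.
Proof.
elim: n => [|n [mu /= ->]]; first by exists (dirac (0 : 'rV[R]_0)).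
pose pm : {measure set (measurableTypeR R * 'rV[R]_n)%type -> \bar R} :=
  product_measure1 (@lebesgue_measure R) mu.
have mcons := @measurable_rVcons n.
pose m : {measure set 'rV[R]_n.+1 -> \bar R} :=
  measure_function_pushforward__canonical__measure_function_Measure pm mcons.
have sm : sigma_finite setT m.
  have /sigma_finiteP[F [FT ndF mF]] := sigma_finiteT (@lebesgue_measure R).
  have /sigma_finiteP[G [GT ndG mG]] := sigma_finiteT mu.
  pose g (v : 'rV[R]_n.+1) : measurableTypeR R * 'rV[R]_n :=
    (v ord0 ord0, \row_i v ord0 (lift ord0 i)).
  have gK : cancel g (@rVcons R n) by move=> v; rewrite -rVcons_surj.
  have Kg : cancel (@rVcons R n) g.
    move=> [a v]; rewrite /g rVcons0; congr pair.
    by apply/rowP => i; rewrite mxE rVconsS.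
  have mg : measurable_fun setT g.
    apply/measurable_fun_pairP; split; first exact: measurable_coord.
    apply/measurable_fun_rVP => i.
    by under eq_fun do rewrite /= mxE; exact: measurable_coord.
  exists (fun i => g @^-1` (F i `*` G i)).
    apply/seteqP; split => // v _ /=.
    have [i _ Fi] : (\bigcup_i F i) (v ord0 ord0) by rewrite -FT.
    have [j _ Gj] : (\bigcup_i G i) (g v).2 by rewrite -GT.
    exists (maxn i j) => //; split => /=.
      by move: (v _ _) Fi; exact/subsetPset/ndF/leq_maxl.
    by move: Gj; exact/subsetPset/ndG/leq_maxr.
  move=> i; have [mFi Fi] := mF i; have [mGi Gi] := mG i; split.
    by rewrite -[X in measurable X]setTI; apply: mg => //; exact: measurableX.
  rewrite /m /= /pushforward -comp_preimage (_ : g \o _ = id); last first.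
    by apply/funext => p /=; rewrite Kg.
  by rewrite /= product_measure1E// lte_mul_pinfty// ge0_fin_numE.
pose msm := Measure_isSigmaFinite.Build _ _ _ m sm.
pose sfm : {sigma_finite_measure set 'rV[R]_n.+1 -> \bar R} :=
  HB.pack (Measure.sort m) msm.
by exists sfm.
Qed.

Let lebesgue_rV_set0 n : @lebesgue_rV R n set0 = 0%E.
Proof. by have [mu ->] := lebesgue_rV_ex n; exact: measure0. Qed.

Let lebesgue_rV_ge0 n A : (0 <= @lebesgue_rV R n A)%E.
Proof. by have [mu ->] := lebesgue_rV_ex n; exact: measure_ge0. Qed.

Let lebesgue_rV_semi_sigma_additive n : semi_sigma_additive (@lebesgue_rV R n).
Proof.
by have [mu ->] := lebesgue_rV_ex n; exact: measure_semi_sigma_additive.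
Qed.

HB.instance Definition _ n := isMeasure.Build _ _ _ (@lebesgue_rV R n)
  (lebesgue_rV_set0 n) (@lebesgue_rV_ge0 n) (@lebesgue_rV_semi_sigma_additive n).

Let lebesgue_rV_sigma_finite n : sigma_finite setT (@lebesgue_rV R n).
Proof. by have [mu ->] := lebesgue_rV_ex n; exact: sigma_finiteT. Qed.

HB.instance Definition _ n := Measure_isSigmaFinite.Build _ _ _
  (@lebesgue_rV R n) (@lebesgue_rV_sigma_finite n).

Lemma lebesgue_rV_box n (a b : 'rV[R]_n) : (forall i, a ord0 i <= b ord0 i) ->
  lebesgue_rV [set v : 'rV[R]_n | forall i, a ord0 i <= v ord0 i <= b ord0 i] =
  (\prod_(i < n) (b ord0 i - a ord0 i))%:E.
Proof.
elim: n a b => [|n IHn] a b ab.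
  by rewrite big_ord0 /= diracE mem_set// => -[].
pose t (v : 'rV[R]_n.+1) : 'rV[R]_n := \row_i v ord0 (lift ord0 i).
have prebox : @rVcons R n @^-1`
      [set v : 'rV[R]_n.+1 | forall i, a ord0 i <= v ord0 i <= b ord0 i] =
    `[a ord0 ord0, b ord0 ord0]%classic `*`
      [set v : 'rV[R]_n | forall i, t a ord0 i <= v ord0 i <= t b ord0 i].
  apply/seteqP; split => [[x v] /= H|[x v] /= [H1 H2] i].
    split; first by have := H ord0; rewrite rVcons0/= in_itv.
    by move=> i; have := H (lift ord0 i); rewrite rVconsS !mxE.
  case: (unliftP ord0 i) => [j|] ->; last by rewrite rVcons0; rewrite in_itv in H1.
  by have := H2 j; rewrite rVconsS !mxE.
rewrite /= /pushforward prebox product_measure1E//; last first.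
  rewrite (_ : mkset _ = \bigcap_(i in [set` finset.setT])
    ((fun v : 'rV[R]_n => v ord0 i) @^-1` `[t a ord0 i, t b ord0 i]%classic)).
    apply: fin_bigcap_measurable => // i _.
    by rewrite -[X in measurable X]setTI; exact: measurable_coord.
  apply/seteqP; split => v /= H i.
    by move=> _; rewrite /= in_itv /=; exact: H.
  by have := H i (finset.in_setT i); rewrite /= in_itv.
rewrite big_ord_recl EFinM; congr (_ * _)%E.
  rewrite /= lebesgue_measure_itv/= lte_fin.
  have := ab ord0; rewrite le_eqVlt => /orP[/eqP ->|->//].
  by rewrite ltxx subrr.
apply: etrans (IHn (t a) (t b) _) _; first by move=> i; rewrite !mxE.
by congr EFin; apply: eq_bigr => i _; rewrite !mxE.
Qed.

End lebesgue_rV_measure.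

(* The library's norm on 'rV[R]_d is the sup norm. *)
Definition enorm {R : realType} {d : nat} (v : 'rV[R]_d) : R :=
  Num.sqrt (\sum_(i < d) v ord0 i ^+ 2).

Definition eball {R : realType} {d : nat} (z : 'rV[R]_d) (r : R) :
  set 'rV[R]_d := [set p | enorm (p - z) < r].

Section densities.
Context {R : realType} {d : nat}.
Implicit Type f : 'rV[R]_d -> R.
Local Open Scope ereal_scope.

Definition prob_density f : Prop :=
  [/\ measurable_fun [set: 'rV[R]_d] f, (forall u, 0 <= f u)%R &
      \int[lebesgue_rV]_u (f u)%:E = 1].

Definition density_measure f (A : set 'rV[R]_d) : \bar R :=
  \int[lebesgue_rV]_(u in A) (f u)%:E.

Definition Lebesgue_point f (x : 'rV[R]_d) : Prop :=
  (lebesgue_rV (eball x r))^-1 *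
    \int[lebesgue_rV]_(u in eball x r) `|f u - f x|%:E @[r --> 0%R^'+] --> 0.

End densities.

Definition voronoi_cell {R : realType} {d : nat} (S : set 'rV[R]_d)
    (s : 'rV[R]_d) : set 'rV[R]_d :=
  [set p | forall s', (S `\ s) s' -> enorm (p - s) <= enorm (p - s')].

Section probability.
Context {R : realType}.

Definition mutually_independent {dO dT} {O : measurableType dO}
    {T : measurableType dT} {I : choiceType} (P : probability O R)
    (X : I -> {RV P >-> T}) : Prop :=
  forall (J : {fset I}) (B : I -> set T), (forall i, measurable (B i)) ->
    P (\bigcap_(i in [set` J]) X i @^-1` B i) =
    (\prod_(i <- J) P (X i @^-1` B i))%E.

Definition iid {dO dT} {O : measurableType dO} {T : measurableType dT}
    {I : choiceType} (P : probability O R) (X : I -> {RV P >-> T})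
    (mu : set T -> \bar R) : Prop :=
  mutually_independent X /\
  forall i A, measurable A -> distribution P (X i) A = mu A.

(* The limit may live on another probability space. *)
Definition cvg_in_distribution {d1 d2} {O1 : measurableType d1}
    {O2 : measurableType d2} {S : topologicalType}
    (P : probability O1 R) (Y : nat -> O1 -> S)
    (Q : probability O2 R) (Z : O2 -> S) : Prop :=
  forall h : S -> R, continuous h -> (exists M : R, forall s, `|h s| <= M) ->
    ('E_P[h \o Y n] @[n --> \oo] --> 'E_Q[h \o Z])%E.

End probability.

Section voronoi_masses.
Context {R : realType} {d : nat}.

(* {X_1(w), ..., X_n(w)}, the sequence being indexed from 0. *)
Definition sample {dO} {O : measurableType dO} {P : probability O R}
    (X : nat -> {RV P >-> 'rV[R]_d}) (n : nat) (w : O) : set 'rV[R]_d :=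
  [set X i w | i in `I_n].

(* n mu_f(C), with C the cell of x in the Voronoi diagram generated by S
   and X_1(w), ..., X_n(w). *)
Definition scaled_cell_mass {dO} {O : measurableType dO} {P : probability O R}
    (f : 'rV[R]_d -> R) (X : nat -> {RV P >-> 'rV[R]_d})
    (S : set 'rV[R]_d) (x : 'rV[R]_d) (n : nat) (w : O) : R :=
  n%:R * fine (density_measure f (voronoi_cell (S `|` sample X n w) x)).

Lemma measurable_enormB {dO} {O : measurableType dO} (Y Z : O -> 'rV[R]_d) :
  measurable_fun setT Y -> measurable_fun setT Z ->
  measurable_fun setT (fun w => enorm (Y w - Z w)).
Proof.
move=> mY mZ; rewrite /enorm.
apply: (@measurableT_comp _ _ _ _ _ _ (@Num.sqrt R)).
  by apply: continuous_measurable_fun; exact: sqrt_continuous.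
apply: measurable_sum => i; apply: measurable_funX.
under eq_fun do rewrite !mxE.
by apply: measurable_funB; exact: (measurableT_comp (measurable_coord i)).
Qed.

Lemma measurable_scaled_cell_mass {dO} {O : measurableType dO}
    {P : probability O R} (f : 'rV[R]_d -> R) (X : nat -> {RV P >-> 'rV[R]_d})
    (S : set 'rV[R]_d) (x : 'rV[R]_d) (n : nat) :
  prob_density f -> finite_set S ->
  measurable_fun [set: O] (scaled_cell_mass f X S x n).
Proof.
move=> [mf f0 _] finS; apply: measurable_funM => //.
apply: (@measurableT_comp _ _ _ _ _ _ (@fine R)) => //.
pose le_dist (Y : O -> 'rV[R]_d) :=
  [set p : O * 'rV[R]_d | enorm (p.2 - x) <= enorm (p.2 - Y p.1)].
have mle Y : measurable_fun setT Y -> measurable (le_dist Y).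
  move=> mY; rewrite -[X in measurable X]setTI; apply: measurable_fun_le => //.
    exact: measurable_enormB.
  by apply: measurable_enormB => //; exact: measurableT_comp.
pose E := \bigcap_(s in S) le_dist (cst s) `&` \bigcap_(i in `I_n) le_dist (X i).
have mE : measurable E.
  by apply: measurableI; apply: fin_bigcap_measurable => // s _; exact: mle.
have EE w p : E (w, p) <-> voronoi_cell (S `|` sample X n w) x p.
  split=> [[ES EX] s [[Ss|[i ni <-]] _]|H]; [exact: ES|exact: EX|].
  split=> s Ss; rewrite /le_dist /=.
    by have [->|/eqP sx] := eqVneq s x; [|apply: H; split => //; left].
  have [->|/eqP sx] := eqVneq (X s w) x => //.
  by apply: H; split => //; right; exists s.
pose F (p : O * 'rV[R]_d) := (f p.2 * \1_E p)%:E.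
have mF : measurable_fun setT F.
  apply/measurable_EFinP; apply: measurable_funM; first exact: measurableT_comp.
  exact: measurable_indic.
have F0 p : (0 <= F p)%E by rewrite lee_fin mulr_ge0.
rewrite (_ : (fun w => _) = fubini_F (@lebesgue_rV R d) F).
  exact: measurable_fun_fubini_tonelli_F.
apply/funext => w; rewrite /density_measure integral_mkcond.
apply: eq_integral => p _; rewrite /F patchE indicE.
case: ifPn => [/set_mem/EE|/negP wp]; first by move=> ?; rewrite mem_set ?mulr1.
by rewrite memNset ?mulr0// => /EE/mem_set.
Qed.

(* D is the common limit law of the scaled cell masses, whatever the density
   and the nucleus; the theorem of Devroye, Gyorfi, Lugosi and Walk is that
   such a D exists, and it is unique because a limit law is. *)
Definition voronoi_limit_law (D : probability R R) : Prop :=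
  forall (g : 'rV[R]_d -> R) (x : 'rV[R]_d),
    prob_density g -> Lebesgue_point g x -> 0 < g x ->
  forall dO (O : measurableType dO) (P : probability O R)
    (X : nat -> {RV P >-> 'rV[R]_d}), iid X (density_measure g) ->
  cvg_in_distribution P (scaled_cell_mass g X [set x] x) D idfun.

End voronoi_masses.
Arguments voronoi_limit_law {R} d D.

(* Main.v *)
(* Voronoi cells of distinct Lebesgue points are local: cut the neighbourhood of
   x_j into grid cells of mesh e; once each of them contains a sample point, the
   cell of x_j depends only on the sample points in the ball B_j of radius
   O(e) around x_j, and it ignores the other nuclei. With e^d = K / n, this
   fails with probability O(1 / K), uniformly in n, because the masses of the
   grid cells are of order K / n at a Lebesgue point with f(x_j) > 0.
   Functionals of the sample points in disjoint sets A and B have a covariance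
   at most n mu(A) mu(B) (add the points one at a time), here O(K^2 / n). So the
   local cell masses are asymptotically independent, and each of them
   converges to D by hypothesis, applied to the same f and X. Finally,
   products of one-variable test functions determine convergence in
   distribution, by multilinear interpolation. *)
From HB Require Import structures.
Require Import Defs.
From mathcomp Require Import all_boot all_order all_algebra.
From mathcomp Require Import finmap.
From mathcomp Require Import all_classical all_reals all_analysis.
From mathcomp Require Import measurable_realfun.
From mathcomp Require Import ring lra.

Set Implicit Arguments.
Unset Strict Implicit.
Unset Printing Implicit Defensive.

Import Order.TTheory GRing.Theory Num.Theory.
Import numFieldNormedType.Exports.

Local Open Scope classical_set_scope.
Local Open Scope ring_scope.

(** * Expectations of bounded functions *)

(** Each exact cell mass is a function of the whole sample. Moreover the sample size is fixed, so
    even the restrictions of the sample to disjoint sets are dependent: a point in one of them is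
    missing from the others. Locality removes the first dependence; the covariance bound treats the
    second directly, without passing to a Poisson number of points. The two errors pull in opposite
    directions, since larger balls make locality more likely but interact more. The locality error
    is uniform in n, so K is fixed from the tolerance alone, and n grows afterwards. The joint
    diagram and the diagram whose only nucleus is x_j are both compared with the same local
    functional. Thus the joint expectation is compared, at the same n, with a product of
    single-nucleus expectations, and D enters only through the limit of each factor. *)

Section mean.
Context {R : realType} {dO} {O : measurableType dO} (P : probability O R).
Implicit Types f g : O -> R.

(** All variables whose expectation is taken are bounded, so the estimates can be carried out in
    [R]; [expectation_mean] links them to the extended-real expectation. *)
Definition mean f : R := \int[P]_w f w.

Definition bounded_measurable f :=
  measurable_fun setT f /\ exists M, forall w, `|f w| <= M.

Lemma bounded_measurable_integrable f :
  bounded_measurable f -> P.-integrable setT (EFin \o f).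
Proof.
move=> [mf [M fM]]; apply: measurable_bounded_integrable => //.
  by rewrite -ge0_fin_numE// fin_num_measure.
exists M; split; first exact: num_real.
by move=> y My w _ /=; rewrite (le_trans (fM w))// ltW.
Qed.

Lemma bounded_measurable_cst c : bounded_measurable (fun=> c).
Proof. by split => //; exists `|c|. Qed.

Lemma bounded_measurableD f g : bounded_measurable f ->
  bounded_measurable g -> bounded_measurable (fun w => f w + g w).
Proof.
move=> [mf [M fM]] [mg [N gN]]; split; first exact: measurable_funD.
by exists (M + N) => w; rewrite (le_trans (ler_normD _ _))// lerD.
Qed.

Lemma bounded_measurableM f g : bounded_measurable f ->
  bounded_measurable g -> bounded_measurable (fun w => f w * g w).
Proof.
move=> [mf [M fM]] [mg [N gN]]; split; first exact: measurable_funM.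
by exists (M * N) => w; rewrite normrM ler_pM.
Qed.

Lemma bounded_measurableB f g : bounded_measurable f ->
  bounded_measurable g -> bounded_measurable (fun w => f w - g w).
Proof.
move=> [mf [M fM]] [mg [N gN]]; split; first exact: measurable_funB.
by exists (M + N) => w; rewrite (le_trans (ler_normB _ _))// lerD.
Qed.

Lemma bounded_measurable_sum (I : Type) (s : seq I) (F : I -> O -> R) :
  (forall i, bounded_measurable (F i)) ->
  bounded_measurable (fun w => \sum_(i <- s) F i w).
Proof.
move=> bF; elim: s => [|i s IHs].
  by under eq_fun do rewrite big_nil; exact: bounded_measurable_cst.
by under eq_fun do rewrite big_cons; exact: bounded_measurableD.
Qed.

Lemma bounded_measurable_prod (I : Type) (s : seq I) (F : I -> O -> R) :
  (forall i, bounded_measurable (F i)) ->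
  bounded_measurable (fun w => \prod_(i <- s) F i w).
Proof.
move=> bF; elim: s => [|i s IHs].
  by under eq_fun do rewrite big_nil; exact: bounded_measurable_cst.
by under eq_fun do rewrite big_cons; exact: bounded_measurableM.
Qed.

Lemma bounded_measurable_indic A : measurable A -> bounded_measurable (\1_A).
Proof.
move=> mA; split; first exact: measurable_indic.
by exists 1 => w; rewrite indicE; case: (_ \in _); rewrite ?normr1 ?normr0.
Qed.

Lemma bounded_measurable01 f : measurable_fun setT f ->
  (forall w, 0 <= f w <= 1) -> bounded_measurable f.
Proof.
move=> mf f01; split => //; exists 1 => w.
by have /andP[f0 f1] := f01 w; rewrite ger0_norm.
Qed.

Lemma expectation_mean f : bounded_measurable f -> ('E_P[f] = (mean f)%:E)%E.
Proof.
move=> bf; rewrite /mean /Rintegral fineK; first by rewrite unlock.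
exact/integrable_fin_num/bounded_measurable_integrable.
Qed.

Lemma mean_cst c : mean (fun=> c) = c.
Proof.
by rewrite /mean Rintegral_cst//= probability_setT mulr1.
Qed.

Lemma meanD f g : bounded_measurable f -> bounded_measurable g ->
  mean (fun w => f w + g w) = mean f + mean g.
Proof.
by move=> bf bg; rewrite /mean RintegralD//; exact: bounded_measurable_integrable.
Qed.

Lemma meanB f g : bounded_measurable f -> bounded_measurable g ->
  mean (fun w => f w - g w) = mean f - mean g.
Proof.
by move=> bf bg; rewrite /mean RintegralB//; exact: bounded_measurable_integrable.
Qed.

Lemma meanZ c f : bounded_measurable f -> mean (fun w => c * f w) = c * mean f.
Proof.
by move=> bf; rewrite /mean RintegralZl//; exact: bounded_measurable_integrable.
Qed.

Lemma mean_sum (I : Type) (s : seq I) (F : I -> O -> R) :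
  (forall i, bounded_measurable (F i)) ->
  mean (fun w => \sum_(i <- s) F i w) = \sum_(i <- s) mean (F i).
Proof.
move=> bF; elim: s => [|i s IHs].
  by under eq_fun do rewrite big_nil; rewrite mean_cst big_nil.
under eq_fun do rewrite big_cons.
by rewrite meanD ?IHs ?big_cons//; exact: bounded_measurable_sum.
Qed.

Lemma mean_indic A : measurable A -> mean (\1_A) = fine (P A).
Proof. by move=> mA; rewrite /mean /Rintegral integral_indic// setIT. Qed.

Lemma le_mean f g : bounded_measurable f -> bounded_measurable g ->
  (forall w, f w <= g w) -> mean f <= mean g.
Proof.
move=> bf bg fg; apply: le_Rintegral => //;
  by apply: bounded_measurable_integrable.
Qed.

Lemma mean01 f : measurable_fun setT f ->
  (forall w, 0 <= f w <= 1) -> 0 <= mean f <= 1.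
Proof.
move=> mf f01; have bf := bounded_measurable01 mf f01.
rewrite -{1}(mean_cst 0) -(mean_cst 1); apply/andP; split; apply: le_mean => //;
  by [exact: bounded_measurable_cst|move=> w; have /andP[] := f01 w].
Qed.

Lemma mean_dist f g h : bounded_measurable f -> bounded_measurable g ->
  bounded_measurable h -> (forall w, `|f w - g w| <= h w) ->
  `|mean f - mean g| <= mean h.
Proof.
move=> bf bg bh fgh; have fgh' w : - h w <= f w - g w <= h w by rewrite -ler_norml.
rewrite -meanB// ler_norml; apply/andP; split; last first.
  by apply: le_mean => //;
    [exact: bounded_measurableB|move=> w; have /andP[] := fgh' w].
have -> : - mean h = mean (fun w => 0 - h w).
  by rewrite meanB ?mean_cst ?sub0r//; exact: bounded_measurable_cst.
apply: le_mean => //.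
- by apply: bounded_measurableB => //; exact: bounded_measurable_cst.
- exact: bounded_measurableB.
- by move=> w; rewrite sub0r; have /andP[] := fgh' w.
Qed.

(** Two [[0, 1]]-valued variables differ by at most the indicator of the event where they disagree.
    Locality enters through this bound, with [A] the event [bad]. *)
Lemma mean_dist_off f g A : measurable_fun setT f -> measurable_fun setT g ->
  (forall w, 0 <= f w <= 1) -> (forall w, 0 <= g w <= 1) -> measurable A ->
  (forall w, ~ A w -> f w = g w) -> `|mean f - mean g| <= fine (P A).
Proof.
move=> mf mg f01 g01 mA fg; rewrite -mean_indic//.
apply: mean_dist; try exact: bounded_measurable01.
  exact: bounded_measurable_indic.
move=> w; rewrite indicE; have [wA|/negP wA] := boolP (w \in A).
  by have /andP[? ?] := f01 w; have /andP[? ?] := g01 w; rewrite ler_norml/=; lra.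
by rewrite fg ?subrr ?normr0// => Aw; apply: wA; rewrite inE.
Qed.

End mean.

(* (phi - a)(psi - b) vanishes identically, so the covariance is
   - (E phi - a)(E psi - b). *)
Lemma cov_disjoint_variation {R : realType} {dO} {O : measurableType dO}
    (P : probability O R) (A B : set O) (phi psi : O -> R) :
  measurable A -> measurable B -> A `&` B = set0 ->
  measurable_fun setT phi -> measurable_fun setT psi ->
  (forall w, 0 <= phi w <= 1) -> (forall w, 0 <= psi w <= 1) ->
  (forall w w', ~ A w -> ~ A w' -> phi w = phi w') ->
  (forall w w', ~ B w -> ~ B w' -> psi w = psi w') ->
  `|mean P (fun w => phi w * psi w) - mean P phi * mean P psi| <=
  fine (P A) * fine (P B).
Proof.
have key (C : set O) (chi : O -> R) : measurable C -> measurable_fun setT chi ->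
    (forall w, 0 <= chi w <= 1) ->
    (forall w w', ~ C w -> ~ C w' -> chi w = chi w') ->
    exists c, (forall w, ~ C w -> chi w = c) /\ `|mean P chi - c| <= fine (P C).
  move=> mC mchi chi01 chiC.
  have [c [c01 cC]] : exists c, 0 <= c <= 1 /\ forall w, ~ C w -> chi w = c.
    have [[w0 Cw0]|C0] := pselect (exists w, ~ C w).
      by exists (chi w0); split => // w Cw; exact: chiC.
    (* If [C] is the whole space, any constant in [[0, 1]] will do, the bound [P C] being 1. *)
    exists 0; split; first by rewrite lexx ler01.
    by move=> w Cw; exfalso; apply: C0; exists w.
  exists c; split => //; rewrite -{1}(mean_cst P c).
  by apply: mean_dist_off.
move=> mA mB AB mphi mpsi phi01 psi01 phiA psiB.
have [a [aA ale]] := key _ _ mA mphi phi01 phiA.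
have [b [bB ble]] := key _ _ mB mpsi psi01 psiB.
have bphi := bounded_measurable01 mphi phi01.
have bpsi := bounded_measurable01 mpsi psi01.
have -> : (fun w => phi w * psi w) = (fun w => (a * psi w + b * phi w) + - (a * b)).
  apply/funext => w; have [Aw|Aw] := pselect (A w).
    have Bw : ~ B w by move=> Bw; have : (A `&` B) w by []; rewrite AB.
    by rewrite (bB _ Bw); ring.
  by rewrite (aA _ Aw); ring.
have bZ c (g : O -> R) : bounded_measurable g -> bounded_measurable (fun w => c * g w).
  by apply: bounded_measurableM; exact: bounded_measurable_cst.
rewrite !meanD ?meanZ ?mean_cst//; try exact: bZ; last 2 first.
- by apply: bounded_measurableD; exact: bZ.
- exact: bounded_measurable_cst.
rewrite (_ : _ - _ = - ((mean P phi - a) * (mean P psi - b))); last by ring.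
by rewrite normrN normrM ler_pM.
Qed.

Lemma probability_bigsetU_le {R : realType} {dO} {O : measurableType dO}
    (P : probability O R) (J : Type) (s : seq J) (A : J -> set O) (p : R) :
  (forall j, measurable (A j)) -> (forall j, fine (P (A j)) <= p) ->
  fine (P (\big[setU/set0]_(j <- s) A j)) <= (size s)%:R * p.
Proof.
move=> mA Ap; elim: s => [|j s IHs]; first by rewrite big_nil measure0 mul0r.
have mU : measurable (\big[setU/set0]_(i <- s) A i) by exact: bigsetU_measurable.
rewrite big_cons -lee_fin fineK ?fin_num_measure//; last exact: measurableU.
apply: le_trans (measureU2 _ _ _) _ => //.
rewrite /= -natr1 addrC mulrDl mul1r EFinD leeD//.
  by rewrite -[leLHS]fineK ?lee_fin// fin_num_measure.
by rewrite -[leLHS]fineK ?lee_fin// fin_num_measure.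
Qed.

Lemma prod01 {R : realType} (J : Type) (s : seq J) (c : J -> R) :
  (forall j, 0 <= c j <= 1) -> 0 <= \prod_(j <- s) c j <= 1.
Proof.
move=> c01; apply: (big_ind (fun y => 0 <= y <= 1)) => //.
- by rewrite ler01 lexx.
- by move=> y z /andP[y0 y1] /andP[z0 z1]; rewrite mulr_ge0//= mulr_ile1.
Qed.

(** * Independence *)

Section independent_pair.
Context {R : realType} {dO d1 d2} {O : measurableType dO}
  {T1 : measurableType d1} {T2 : measurableType d2} (P : probability O R).

Definition independent_maps (U : O -> T1) (V : O -> T2) :=
  forall A B, measurable A -> measurable B ->
    P (U @^-1` A `&` V @^-1` B) = (P (U @^-1` A) * P (V @^-1` B))%E.

(** The law of the pair is a product measure, by uniqueness on rectangles; Tonelli then freezes the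
    first variable. *)
Lemma integral_independent (U : {mfun O >-> T1}) (V : {mfun O >-> T2})
    (F : T1 * T2 -> \bar R) : independent_maps U V ->
  measurable_fun setT F -> (forall t, 0 <= F t)%E ->
  (\int[P]_w F (U w, V w) = \int[P]_w' \int[P]_w F (U w', V w))%E.
Proof.
move=> UV mF F0.
have mUV : measurable_fun setT (fun w => (U w, V w)).
  by apply/measurable_fun_pairP; split; exact: measurable_funPT.
pose UVm := mfun_Sub (mem_set mUV : (fun w => (U w, V w)) \in mfun).
have prodE C : measurable C ->
    (distribution P U \x distribution P V)%E C = distribution P UVm C.
  apply: product_measure_unique => A B mA mB.
  by rewrite /distribution /pushforward -UV.
transitivity (\int[distribution P UVm]_t F t)%E.
  by rewrite ge0_integral_distribution.
transitivity (\int[distribution P U \x distribution P V]_t F t)%E.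
  by apply: eq_measure_integral => C mC _; rewrite [RHS]prodE.
rewrite fubini_tonelli1// ge0_integral_distribution//.
- apply: eq_integral => w _ /=; rewrite /fubini_F ge0_integral_distribution//.
  exact: measurableT_comp.
- exact: measurable_fun_fubini_tonelli_F.
- by move=> t; apply: integral_ge0.
Qed.

Lemma mean_independent (U : {mfun O >-> T1}) (V : {mfun O >-> T2})
    (F : T1 * T2 -> R) : independent_maps U V ->
  measurable_fun setT F -> (forall t, 0 <= F t <= 1) ->
  mean P (fun w => F (U w, V w)) =
  mean P (fun w' => mean P (fun w => F (U w', V w))).
Proof.
move=> UV mF F01; rewrite {1 2}/mean /Rintegral.
rewrite (@integral_independent U V (EFin \o F))//.
- congr fine; apply: eq_integral => w' _; rewrite -expectation_mean ?unlock//.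
  apply: bounded_measurable01 => // .
  exact: (measurableT_comp (measurableT_comp mF (pair1_measurable (U w')))).
- exact/measurable_EFinP.
- by move=> t /=; rewrite lee_fin; have /andP[] := F01 t.
Qed.

End independent_pair.

Section independent_tuple.
Context {R : realType} {dO d} {O : measurableType dO} {T : measurableType d}
  {I : choiceType} (P : probability O R) (X : I -> {RV P >-> T}).

Definition tuple_map n (s : n.-tuple I) (w : O) : n.-tuple T :=
  map_tuple (X ^~ w) s.

Lemma measurable_tuple_map n (s : n.-tuple I) :
  measurable_fun setT (tuple_map s).
Proof.
apply/measurable_fun_tnthP => i.
rewrite (_ : _ \o _ = X (tnth s i)); first exact: measurable_funPT.
by apply/funext => w /=; rewrite tnth_map.
Qed.

HB.instance Definition _ n (s : n.-tuple I) :=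
  isMeasurableFun.Build _ _ _ _ (tuple_map s) (measurable_tuple_map s).

(** The sides are attached to indices in [I] and not to positions, so that the event of falling in a
    box is an intersection over a finite set of indices, as in [mutually_independent]. *)
Let box n (s : n.-tuple I) (B : I -> set T) : set (n.-tuple T) :=
  [set t | forall l, B (tnth s l) (tnth t l)].

Let measurable_box n (s : n.-tuple I) B : (forall i, measurable (B i)) ->
  measurable (box s B).
Proof.
move=> mB; rewrite (_ : box s B = \bigcap_(l in [set` finset.setT])
    ((fun t : n.-tuple T => tnth t l) @^-1` B (tnth s l))).
  apply: fin_bigcap_measurable => // l _.
  by rewrite -[X in measurable X]setTI; exact: measurable_tnth.
apply/seteqP; split=> t /= H l; first by move=> _; exact: H.
exact/H/finset.in_setT.
Qed.

Let boxes n (s : n.-tuple I) : set (set (n.-tuple T)) :=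
  [set box s B | B in [set B | forall i, measurable (B i)]].

Let measurable_boxes n (s : n.-tuple I) : uniq s ->
  @measurable _ (n.-tuple T) = <<s boxes s >>.
Proof.
move=> us; apply/seteqP; split; last first.
  apply: smallest_sub; first exact: sigma_algebra_measurable.
  by move=> _ [B mB <-]; exact: measurable_box.
apply: smallest_sub; first exact: smallest_sigma_algebra.
move=> A; rewrite -bigcup_seq => -[l _ /= [B mB <-]] /=.
rewrite setTI; apply: sub_sigma_algebra.
(* A cylinder over position [l] is a box whose other sides are full; [uniq s] ensures that no other
   position carries the index [tnth s l]. *)
exists (fun i => if i == tnth s l then B else setT); first by move=> i; case: ifP.
apply/seteqP; split=> t /= H; first by have := H l; rewrite eqxx.
move=> j; case: eqP => // /(tuple_uniqP _ us) ->//.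
Qed.

(** For fixed [A], both sides are finite measures in the event about the tuple. They agree on boxes,
    which are stable under intersection and generate the sigma-algebra. *)
Lemma independent_tuple n (s : n.-tuple I) i :
  mutually_independent X -> uniq s -> i \notin s ->
  independent_maps P (X i) (tuple_map s).
Proof.
move=> indX us i_s A C mA mC.
have mXA : measurable (X i @^-1` A) by exact: measurable_funPTI.
pose m1 : {measure set _ -> \bar R} :=
  measure_function_pushforward__canonical__measure_function_Measure
    (mrestr P mXA) (measurable_tuple_map s).
pose a : {nonneg R} := NngNum (fine_ge0 (measure_ge0 P (X i @^-1` A))).
pose m2 : {measure set _ -> \bar R} := mscale a (distribution P (tuple_map s)).
have m1E D : m1 D = P (X i @^-1` A `&` tuple_map s @^-1` D).
  by rewrite /m1/= /pushforward /mrestr setIC.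
have m2E D : m2 D = (P (X i @^-1` A) * P (tuple_map s @^-1` D))%E.
  by rewrite /m2/= /mscale/= fineK ?fin_num_measure.
rewrite -m1E -m2E; apply: (measure_unique (boxes s) (fun=> setT)) => //.
- exact: measurable_boxes.
- move=> _ _ [B1 mB1 <-] [B2 mB2 <-].
  exists (fun i => B1 i `&` B2 i); first by move=> j; exact: measurableI.
  apply/seteqP; split=> t /=; first by move=> H; split=> l; have [] := H l.
  by move=> [H1 H2] l; split; [exact: H1|exact: H2].
- by move=> _; exists (fun=> setT) => //; apply/seteqP; split.
- by rewrite bigcup_const.
- move=> _ [B mB <-]; rewrite m1E m2E.
  (* As [i] is not in [s], the side at [i] is free to be [A] without affecting the constraints on
     the tuple. *)
  pose B' j := if j == i then A else B j.
  have mB' j : measurable (B' j) by rewrite /B'; case: ifP.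
  have i_fs : i \notin [fset j in (s : seq I)]%fset by rewrite inE.
  have boxE : tuple_map s @^-1` box s B =
      \bigcap_(j in [set` [fset j in (s : seq I)]%fset]) X j @^-1` B j.
    apply/seteqP; split=> w /= H.
      by move=> j /=; rewrite inE => /tnthP[l ->]; have := H l; rewrite tnth_map.
    by move=> l; rewrite tnth_map; apply: H; rewrite /= inE mem_tnth.
  have -> : X i @^-1` A `&` tuple_map s @^-1` box s B =
      \bigcap_(j in [set` (i |` [fset j in (s : seq I)])%fset]) X j @^-1` B' j.
    rewrite boxE; apply/seteqP; split=> w /=.
      move=> [Aw H] j /=; rewrite !inE /B' => /orP[/eqP->|js]; first by rewrite eqxx.
      by rewrite ifN; [apply: H; rewrite /= inE|apply: contraNneq i_s => <-].
    move=> H; split.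
      by have := H i; rewrite /= /B' eqxx; apply; rewrite !inE eqxx.
    move=> j /=; rewrite inE => js; have := H j; rewrite /= /B' ifN; last first.
      by apply: contraNneq i_s => <-.
    by apply; rewrite !inE js orbT.
  rewrite boxE !indX// big_fsetU1//= /B' eqxx; congr (_ * _)%E.
  apply: eq_fbigr => j; rewrite inE => js _.
  by rewrite ifN//; apply: contraNneq i_s => <-.
- by move=> _; rewrite m1E preimage_setT setIT ltey_eq fin_num_measure.
Qed.

End independent_tuple.

(** * Covariance of functionals of disjoint parts of a sample *)

Section tuple_covariance.
Context {R : realType} {dO d} {O : measurableType dO} {T : measurableType d}
  {I : choiceType} (P : probability O R) (X : I -> {RV P >-> T}).

Lemma measurable_mean_section (F : T * O -> R) : measurable_fun setT F ->
  (forall t, 0 <= F t) ->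
  measurable_fun setT (fun u => mean P (fun w => F (u, w))).
Proof.
move=> mF F0; apply: (@measurableT_comp _ _ _ _ _ _ (@fine R)) => //.
rewrite -[X in measurable_fun _ X]/(fubini_F P (EFin \o F)).
apply: measurable_fun_fubini_tonelli_F; first exact/measurable_EFinP.
by move=> t; rewrite lee_fin.
Qed.

Definition depends_on (A : set T) n (F : n.-tuple T -> R) :=
  forall t t', (forall i, tnth t i = tnth t' i \/
    (~ A (tnth t i) /\ ~ A (tnth t' i))) -> F t = F t'.

Lemma depends_on_cons (A : set T) n (F : n.+1.-tuple T -> R) u :
  depends_on A F -> depends_on A (fun t => F (cons_tuple u t)).
Proof.
move=> AF t t' tt'; apply: AF => i.
case: (unliftP ord0 i) => [j|] ->; last by left.
by rewrite !tnthS; exact: tt'.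
Qed.

Lemma depends_on_head (A : set T) n (F : n.+1.-tuple T -> R) u u' t :
  depends_on A F -> ~ A u -> ~ A u' ->
  F (cons_tuple u t) = F (cons_tuple u' t).
Proof.
move=> AF Au Au'; apply: AF => i.
case: (unliftP ord0 i) => [j|] ->; last by right.
by rewrite !tnthS; left.
Qed.

(** Law of total covariance, conditioning on the first point. The conditional covariance is at most
    [n%:R * (a * b)] by induction, for every value of that point. The conditional means are constant
    off [A] and off [B] respectively, so [cov_disjoint_variation] bounds their covariance by one
    more [a * b]. *)
Lemma tuple_covariance (A B : set T) (a b : R) n (s : n.-tuple I)
    (F G : n.-tuple T -> R) : mutually_independent X -> uniq s ->
  measurable A -> measurable B -> A `&` B = set0 ->
  (forall i, fine (P (X i @^-1` A)) <= a) ->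
  (forall i, fine (P (X i @^-1` B)) <= b) ->
  measurable_fun setT F -> measurable_fun setT G ->
  (forall t, 0 <= F t <= 1) -> (forall t, 0 <= G t <= 1) ->
  depends_on A F -> depends_on B G ->
  `|mean P (fun w => F (tuple_map X s w) * G (tuple_map X s w)) -
    mean P (F \o tuple_map X s) * mean P (G \o tuple_map X s)|
    <= n%:R * (a * b).
Proof.
move=> indX us mA mB AB Aa Bb.
elim: n s us F G => [|n IHn] s us F G mF mG F01 G01 AF BG; set V := tuple_map X s.
  have V0 w : V w = [tuple] by rewrite tuple0.
  rewrite (_ : F \o V = fun=> F [tuple]); last by apply/funext => w /=; rewrite V0.
  rewrite (_ : G \o V = fun=> G [tuple]); last by apply/funext => w /=; rewrite V0.
  under eq_fun do rewrite V0.
  by rewrite !mean_cst subrr normr0 mul0r.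
case/tupleP: s us @V => i s /= /andP[i_s us]; set V := tuple_map X _.
have VE w : V w = cons_tuple (X i w) (tuple_map X s w) by apply/val_inj.
pose cns (u : T * n.-tuple T) : n.+1.-tuple T := cons_tuple u.1 u.2.
have mcns : measurable_fun setT cns by exact: measurable_cons.
have FG01 t : 0 <= F t * G t <= 1.
  have /andP[F0 F1] := F01 t; have /andP[G0 G1] := G01 t.
  by rewrite mulr_ge0//= mulr_ile1.
have mFG : measurable_fun setT (fun t => F t * G t) by exact: measurable_funM.
have split_mean (K : n.+1.-tuple T -> R) : measurable_fun setT K ->
    (forall t, 0 <= K t <= 1) -> mean P (K \o V) =
    mean P (fun w' => mean P (fun w => K (cons_tuple (X i w') (tuple_map X s w)))).
  move=> mK K01.
  rewrite -(mean_independent (F := K \o cns) (independent_tuple indX us i_s))//.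
  - by congr mean; apply/funext => w /=; rewrite VE.
  - exact: measurableT_comp.
  - by move=> t; exact: K01.
have mcnsu u : measurable_fun setT (fun w => cons_tuple u (tuple_map X s w)).
  exact: (measurableT_comp (measurableT_comp mcns (pair1_measurable u))
    (measurable_tuple_map X s)).
pose phi u := mean P (fun w => F (cons_tuple u (tuple_map X s w))).
pose psi u := mean P (fun w => G (cons_tuple u (tuple_map X s w))).
pose chi u := mean P (fun w =>
  F (cons_tuple u (tuple_map X s w)) * G (cons_tuple u (tuple_map X s w))).
have msec : forall K : n.+1.-tuple T -> R, measurable_fun setT K ->
    (forall t, 0 <= K t <= 1) ->
    measurable_fun setT (fun u => mean P (fun w => K (cons_tuple u (tuple_map X s w)))).
  move=> K mK K01.
  apply: (@measurable_mean_section (fun p => K (cns (p.1, tuple_map X s p.2)))).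
    apply: measurableT_comp => //; apply: measurableT_comp => //.
    apply/measurable_fun_pairP; split; first exact: measurable_fst.
    exact: (measurableT_comp (measurable_tuple_map X s) measurable_snd).
  by move=> t; have /andP[] := K01 (cns (t.1, tuple_map X s t.2)).
have mphi : measurable_fun setT phi by exact: msec.
have mpsi : measurable_fun setT psi by exact: msec.
have mchi : measurable_fun setT chi by exact: (msec (fun t => F t * G t)).
have sec01 : forall (K : n.+1.-tuple T -> R) u, measurable_fun setT K ->
    (forall t, 0 <= K t <= 1) ->
    0 <= mean P (fun w => K (cons_tuple u (tuple_map X s w))) <= 1.
  by move=> K u mK K01; apply: mean01 => //; exact: measurableT_comp.
have phi01 u : 0 <= phi u <= 1 by exact: sec01.
have psi01 u : 0 <= psi u <= 1 by exact: sec01.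
have chi01 u : 0 <= chi u <= 1 by exact: (sec01 (fun t => F t * G t)).
have mX (g : T -> R) : measurable_fun setT g -> measurable_fun setT (g \o X i).
  by move=> mg; exact: measurableT_comp.
rewrite (split_mean _ mF F01) (split_mean _ mG G01).
rewrite (split_mean (fun t => F t * G t) mFG FG01).
rewrite -/(mean P (phi \o X i)) -/(mean P (psi \o X i)) -/(mean P (chi \o X i)).
have mXi C : measurable C -> measurable (X i @^-1` C).
  by move=> mC; exact: measurable_funPTI.
have step1 : `|mean P (chi \o X i) - mean P (fun w => phi (X i w) * psi (X i w))|
    <= n%:R * (a * b).
  rewrite -[leRHS](mean_cst P); apply: mean_dist.
  - by apply: bounded_measurable01; [exact: (mX chi)|move=> w; exact: chi01].
  - apply: bounded_measurableM; apply: bounded_measurable01.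
    + exact: (mX phi).
    + by move=> w; exact: phi01.
    + exact: (mX psi).
    + by move=> w; exact: psi01.
  - exact: bounded_measurable_cst.
  move=> w; apply: (IHn s us (fun t => F (cons_tuple (X i w) t))
    (fun t => G (cons_tuple (X i w) t))) => //.
  - exact: (measurableT_comp (measurableT_comp mF mcns) (pair1_measurable (X i w))).
  - exact: (measurableT_comp (measurableT_comp mG mcns) (pair1_measurable (X i w))).
  - exact: depends_on_cons.
  - exact: depends_on_cons.
have step2 : `|mean P (fun w => phi (X i w) * psi (X i w)) -
    mean P (phi \o X i) * mean P (psi \o X i)| <= a * b.
  apply: le_trans (_ : _ <= fine (P (X i @^-1` A)) * fine (P (X i @^-1` B))) _.
    apply: cov_disjoint_variation; try exact: mXi.
    - by rewrite -preimage_setI AB preimage_set0.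
    - exact: (mX phi).
    - exact: (mX psi).
    - by move=> w; exact: phi01.
    - by move=> w; exact: psi01.
    - move=> w w' Aw Aw' /=; congr mean; apply/funext => v.
      exact: depends_on_head AF Aw Aw'.
    - move=> w w' Bw Bw' /=; congr mean; apply/funext => v.
      exact: depends_on_head BG Bw Bw'.
  by apply: ler_pM; rewrite ?fine_ge0.
rewrite -(subrKA (mean P (fun w => phi (X i w) * psi (X i w)))).
rewrite (le_trans (ler_normD _ _))//.
by rewrite -[n.+1]addn1 natrD mulrDl mul1r lerD.
Qed.

End tuple_covariance.

Section tuple_decoupling.
Context {R : realType} {dO d} {O : measurableType dO} {T : measurableType d}
  {I : choiceType} (P : probability O R) (X : I -> {RV P >-> T}).

(** Factors are split off one at a time. The product of the remaining ones depends on the points in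
    the union of their sets, of mass at most [(size J)%:R * p], and is disjoint in this sense from
    the factor split off; each split thus costs at most [n%:R * (size J)%:R * p ^+ 2]. *)
Lemma tuple_decoupling (K : choiceType) (J : seq K) (A : K -> set T) (p : R) n
    (s : n.-tuple I) (F : K -> n.-tuple T -> R) :
  mutually_independent X -> uniq s -> uniq J ->
  (forall j, measurable (A j)) -> (forall j, measurable_fun setT (F j)) ->
  (forall j j', j != j' -> A j `&` A j' = set0) ->
  (forall i j, fine (P (X i @^-1` A j)) <= p) ->
  (forall j t, 0 <= F j t <= 1) -> (forall j, depends_on (A j) (F j)) ->
  `|mean P (fun w => \prod_(j <- J) F j (tuple_map X s w)) -
    \prod_(j <- J) mean P (F j \o tuple_map X s)|
    <= n%:R * (size J)%:R ^+ 2 * p ^+ 2.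
Proof.
move=> indX us uJ mA mF A0 Ap F01 AF.
elim: J uJ => [_|j J IHJ /= /andP[jJ uJ]].
  rewrite big_nil; under eq_fun do rewrite big_nil.
  by rewrite mean_cst subrr normr0 expr0n/= mulr0 mul0r.
have {}IHJ := IHJ uJ; rewrite big_cons; under eq_fun do rewrite big_cons.
pose AJ := \big[setU/set0]_(j <- J) A j.
pose G t := \prod_(j <- J) F j t.
have mAJ : measurable AJ by apply: bigsetU_measurable.
have AJp i : fine (P (X i @^-1` AJ)) <= (size J)%:R * p.
  exact: (@probability_bigsetU_le _ _ _ (distribution P (X i)) _ J A p mA (Ap i)).
have AjJ : A j `&` AJ = set0.
  rewrite /AJ big_distrr/= big1_seq// => j' /andP[_ j'J].
  by apply: A0; apply: contraNneq jJ => ->.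
have mG : measurable_fun setT G by apply: measurable_prod.
have GAJ : depends_on AJ G.
  move=> t t' tt'; apply: eq_big_seq => j' j'J; apply: (AF j') => i.
  have [->|[Bt Bt']] := tt' i; [by left|right].
  by split=> Aj'; [apply: Bt|apply: Bt']; rewrite /AJ -bigcup_seq; exists j'.
have G01 t : 0 <= G t <= 1 by exact: prod01.
have step1 := tuple_covariance indX us (mA j) mAJ AjJ (Ap ^~ j) AJp
  (mF j) mG (F01 j) G01 (AF j) GAJ.
have mFV : measurable_fun setT (F j \o tuple_map X s).
  exact: (measurableT_comp (mF j) (measurable_tuple_map X s)).
have /andP[Fj0 Fj1] : 0 <= mean P (F j \o tuple_map X s) <= 1.
  by apply: mean01 => // w; exact: F01.
have step2 : `|mean P (F j \o tuple_map X s) * mean P (G \o tuple_map X s) -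
    mean P (F j \o tuple_map X s) * \prod_(j <- J) mean P (F j \o tuple_map X s)|
    <= n%:R * (size J)%:R ^+ 2 * p ^+ 2.
  rewrite -mulrBr normrM (ger0_norm Fj0).
  by apply: le_trans IHJ; rewrite ler_piMl.
rewrite -(subrKA (mean P (F j \o tuple_map X s) * mean P (G \o tuple_map X s))).
rewrite (le_trans (ler_normD _ _))// (le_trans (lerD step1 step2))//.
(* This is exactly the slack: [(a + 1)^2 - a - a^2 = a + 1] with [a] the size of [J]. *)
have : 0 <= n%:R * (size J).+1%:R * p ^+ 2 :> R by rewrite mulr_ge0 ?sqr_ge0.
rewrite -[(size J).+1%:R]natr1; move: ((size J)%:R : R) (n%:R : R) => a b.
nra.
Qed.

(** Serves the limit side, where it factors the expectation of a product test function of the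
    variables [Z j]. *)
Lemma mean_prod_independent (s : seq I) (phi : I -> T -> R) :
  mutually_independent X -> uniq s ->
  (forall i, measurable_fun setT (phi i)) -> (forall i u, 0 <= phi i u <= 1) ->
  mean P (fun w => \prod_(i <- s) phi i (X i w)) =
  \prod_(i <- s) mean P (phi i \o X i).
Proof.
move=> indX us mphi phi01; elim: s us => [|i s IHs] /=.
  by under eq_fun do rewrite big_nil; rewrite big_nil mean_cst.
move=> /andP[i_s us]; rewrite big_cons -(IHs us).
under eq_fun do rewrite big_cons.
pose G (t : (size s).-tuple T) :=
  \prod_(l < size s) phi (tnth (in_tuple s) l) (tnth t l).
have GE w : \prod_(j <- s) phi j (X j w) = G (tuple_map X (in_tuple s) w).
  rewrite (big_tnth _ _ s)/G; apply: eq_bigr => l _.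
  by rewrite /tuple_map tnth_map.
have mG : measurable_fun setT G.
  apply: measurable_prod => l _.
  exact: (measurableT_comp (mphi _) (@measurable_tnth _ _ _ _)).
have G01 t : 0 <= G t <= 1 by exact: prod01.
have bG : bounded_measurable (G \o tuple_map X (in_tuple s)).
  apply: bounded_measurable01; last by move=> w; exact: G01.
  exact: (measurableT_comp mG (measurable_tuple_map X _)).
transitivity (mean P (fun w => phi i (X i w) * G (tuple_map X (in_tuple s) w))).
  by congr mean; apply/funext => w; rewrite GE.
rewrite (mean_independent (F := fun q => phi i q.1 * G q.2)
  (independent_tuple (s := in_tuple s) indX us i_s))/=; last 2 first.
- apply: measurable_funM.
    exact: (measurableT_comp (mphi i) measurable_fst).
  exact: (measurableT_comp mG measurable_snd).
- move=> t; have /andP[? ?] := phi01 i t.1; have /andP[? ?] := G01 t.2.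
  by rewrite mulr_ge0//= mulr_ile1.
under eq_fun => w' do
  rewrite (@meanZ _ _ _ P _ (G \o tuple_map X (in_tuple s)) bG) mulrC.
rewrite meanZ; last first.
  apply: bounded_measurable01; last by move=> w; exact: phi01.
  exact: (measurableT_comp (mphi i)).
rewrite mulrC; congr (_ * mean P _).
by apply/funext => w /=; rewrite GE.
Qed.

(** All of the first [n] points must fall in the complement of [C], and independence multiplies
    factors that are at most [1 - q]. *)
Lemma probability_miss (n : nat) (Y : nat -> {RV P >-> T}) (C : set T) (q : R) :
  mutually_independent Y -> measurable C ->
  (forall i, q <= fine (P (Y i @^-1` C))) ->
  fine (P [set w | forall i, (i < n)%N -> ~ C (Y i w)]) <= (1 - q) ^+ n.
Proof.
move=> indY mC qC; pose J := [fset i in iota 0 n]%fset.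
have mY i D : measurable D -> measurable (Y i @^-1` D).
  by move=> mD; exact: measurable_funPTI.
have -> : [set w | forall i, (i < n)%N -> ~ C (Y i w)] =
    \bigcap_(i in [set` J]) Y i @^-1` (~` C).
  apply/seteqP; split=> w /= H i.
    by rewrite /= !inE mem_iota add0n => /H.
  by move=> i_n; apply: H; rewrite /= !inE mem_iota.
rewrite (indY J (fun=> ~` C)) => [|_]; last exact: measurableC.
rewrite (perm_big (iota 0 n)); last first.
  by apply: uniq_perm; rewrite ?fset_uniq ?iota_uniq// => i; rewrite inE.
have {2}-> : n = size (iota 0 n) by rewrite size_iota.
have qCi i : (P (Y i @^-1` (~` C)) <= (1 - q)%:E)%E.
  rewrite preimage_setC probability_setC ?EFinB ?leeB//; last exact: mY.
  by rewrite -[leRHS]fineK ?lee_fin ?fin_num_measure//; [exact: qC|exact: (mY i C)].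
have q1 : 0 <= 1 - q.
  by rewrite -lee_fin; apply: le_trans (qCi 0).
suff : (0 <= \prod_(i <- iota 0 n) P (Y i @^-1` (~` C)) <=
    ((1 - q) ^+ size (iota 0 n))%:E)%E.
  move=> /andP[h0 h1]; rewrite -lee_fin fineK// ge0_fin_numE//.
  exact: le_lt_trans h1 (ltry _).
elim: (iota 0 n) => [|i s /andP[h0 h1]]; first by rewrite big_nil expr0 lee01 lexx.
by rewrite big_cons mule_ge0//= exprS EFinM lee_pmul.
Qed.

End tuple_decoupling.

(** * Locality of Voronoi cells *)

Section euclidean_norm.
Context {R : realType} {d : nat}.
Implicit Types u v x p s : 'rV[R]_d.

Lemma enorm_sqr v : enorm v ^+ 2 = \sum_(i < d) v ord0 i ^+ 2.
Proof. by rewrite sqr_sqrtr// sumr_ge0// => i _; exact: sqr_ge0. Qed.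

Lemma enorm_ge0 v : 0 <= enorm v.
Proof. exact: sqrtr_ge0. Qed.

Lemma enorm_lt v r : 0 <= r ->
  (enorm v < r) = (\sum_(i < d) v ord0 i ^+ 2 < r ^+ 2).
Proof. by move=> r0; rewrite -enorm_sqr ltr_pXn2r// nnegrE enorm_ge0. Qed.

Lemma enorm_le u v :
  (enorm u <= enorm v) = (\sum_(i < d) u ord0 i ^+ 2 <= \sum_(i < d) v ord0 i ^+ 2).
Proof. by rewrite -!enorm_sqr ler_pXn2r// nnegrE enorm_ge0. Qed.

Lemma coord_le_enorm v i : `|v ord0 i| <= enorm v.
Proof.
rewrite -(@ler_pXn2r _ 2)// ?nnegrE ?enorm_ge0// enorm_sqr.
rewrite real_normK ?num_real// (bigD1 i)//= lerDl.
by apply: sumr_ge0 => j _; exact: sqr_ge0.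
Qed.

Lemma enormN v : enorm (- v) = enorm v.
Proof. by congr Num.sqrt; apply: eq_bigr => i _; rewrite mxE sqrrN. Qed.

Lemma enormZ (t : R) v : 0 <= t -> enorm (t *: v) = t * enorm v.
Proof.
move=> t0; rewrite /enorm -[in RHS](ger0_norm t0) -sqrtr_sqr -sqrtrM ?sqr_ge0//.
by rewrite mulr_sumr; congr Num.sqrt; apply: eq_bigr => i _; rewrite mxE exprMn.
Qed.

(** The parallelogram identity with one square dropped; it stands in for the triangle inequality. In
    its uses both summands are compared with the same radius, and there it is just as sharp. *)
Lemma enormD_sqr u v : enorm (u + v) ^+ 2 <= 2 * (enorm u ^+ 2 + enorm v ^+ 2).
Proof.
rewrite !enorm_sqr -big_split mulr_sumr; apply: ler_sum => i _ /=.
by rewrite mxE; have := sqr_ge0 (u ord0 i - v ord0 i); nra.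
Qed.

Lemma enormB_sqr u v s :
  enorm (u - v) ^+ 2 <= 2 * (enorm (s - u) ^+ 2 + enorm (s - v) ^+ 2).
Proof.
rewrite -(enormN (s - u)) (_ : u - v = - (s - u) + (s - v)); last first.
  by rewrite opprB addrA subrK.
exact: enormD_sqr.
Qed.

(** Along the segment from [x] to [p], the squared distance to [s] minus the squared distance to [x]
    is affine in [t], because the quadratic terms cancel. It is nonnegative at both ends. *)
Lemma voronoi_cell_star (S : set 'rV[R]_d) x p t : 0 <= t <= 1 ->
  voronoi_cell S x p -> voronoi_cell S x (x + t *: (p - x)).
Proof.
move=> /andP[t0 t1] Sp s Ss; have := Sp s Ss.
rewrite !enorm_le -subr_ge0 -sumrB => h; rewrite -subr_ge0 -sumrB.
rewrite (_ : \sum_(i < d) _ = t * (\sum_(i < d) ((p - s) ord0 i ^+ 2 -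
  (p - x) ord0 i ^+ 2)) + (1 - t) * \sum_(i < d) (x - s) ord0 i ^+ 2).
  rewrite addr_ge0// mulr_ge0// ?subr_ge0// sumr_ge0// => i _; exact: sqr_ge0.
rewrite !mulr_sumr -big_split/=; apply: eq_bigr => i _; rewrite !mxE; ring.
Qed.

End euclidean_norm.

Section grid.
Context {R : realType} {d : nat} (d_gt0 : (0 < d)%N).
Implicit Types (u p x : 'rV[R]_d) (e : R).

(* The cells of this cubic grid of mesh e meeting the sphere of radius 4de
   around x cover it, and have a diameter smaller than 4de. *)
Definition grid_cell x e (a : {ffun 'I_d -> 'I_(8 * d).+1}) : set 'rV[R]_d :=
  [set u | forall i, x ord0 i + e * ((a i)%:R - (4 * d)%:R) <= u ord0 i <=
                     x ord0 i + e * ((a i)%:R - (4 * d)%:R) + e].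

(** Meets two demands at once: points of the grid cells are within 5de of [x] in each coordinate,
    hence within 5de sqrt(d) in norm, and points that cannot cut the cell start at distance 8de. The
    power [d ^ 2] avoids square roots. *)
Definition grid_radius e : R := 16 * d%:R ^+ 2 * e.

Let d1 : 1 <= d%:R :> R.
Proof. by rewrite ler1n. Qed.

Lemma measurable_grid_cell x e a : measurable (grid_cell x e a).
Proof.
pose l i := x ord0 i + e * ((a i)%:R - (4 * d)%:R).
rewrite (_ : grid_cell x e a = \bigcap_(i in [set` finset.setT])
    ((fun v : 'rV[R]_d => v ord0 i) @^-1` `[l i, l i + e]%classic)).
  apply: fin_bigcap_measurable => // i _.
  by rewrite -[X in measurable X]setTI; exact: measurable_coord.
apply/seteqP; split => v /= H i.
  by move=> _; rewrite /= in_itv /=; exact: H.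
by have := H i (finset.in_setT i); rewrite /= in_itv.
Qed.

Lemma grid_cell_cover x p e : 0 < e ->
  (* The position of [p] in units of the mesh, counted from the corner of the grid. It ranges over
     the closed interval from 0 to 8d, whose upper end accounts for the index 8d and so for
     [(8 * d).+1] cells per axis. *)
  (forall i, `|p ord0 i - x ord0 i| <= 4 * d%:R * e) ->
  exists a, grid_cell x e a p.
Proof.
move=> e0 px; pose y i := (p ord0 i - x ord0 i) / e + (4 * d)%:R.
have y_itv i : 0 <= y i < (8 * d).+1%:R.
  rewrite /y; have := px i; rewrite ler_norml => /andP[h1 h2].
  have -> : (p ord0 i - x ord0 i) / e + (4 * d)%:R =
    ((p ord0 i - x ord0 i) + 4 * d%:R * e) / e by rewrite natrM; field; lra.
  rewrite divr_ge0//=; [|lra..].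
  by rewrite ltr_pdivrMr// -[(8 * d).+1%:R]natr1 natrM; nra.
have a_lt i : (Num.truncn (y i) < (8 * d).+1)%N.
  have /andP[y0 y8] := y_itv i.
  by rewrite -(ltr_nat R) (le_lt_trans _ y8)// truncn_le.
exists [ffun i => Ordinal (a_lt i)] => i; rewrite ffunE /=.
have /andP[y0 _] := y_itv i.
have := truncn_itv y0; rewrite /y => /andP[].
move: (Num.truncn _) => a; rewrite -(ler_pM2r e0) -(ltr_pM2r e0) mulrDl divfK ?gt_eqF//.
rewrite -[a.+1%:R]natr1 natrM; nra.
Qed.

Lemma grid_cell_diam x e a u p : 0 < e -> grid_cell x e a u ->
  grid_cell x e a p -> enorm (p - u) < 4 * d%:R * e.
Proof.
move=> e0 ua pa; rewrite enorm_lt; last by rewrite !mulr_ge0// ltW.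
apply: (@le_lt_trans _ _ (\sum_(i < d) e ^+ 2)).
  apply: ler_sum => i _; rewrite !mxE.
  have /andP[? ?] := ua i; have /andP[? ?] := pa i.
  by rewrite -real_normK ?num_real// ler_pXn2r// ?nnegrE// ?(ltW e0)// ler_norml; lra.
rewrite sumr_const card_ord -[ltLHS]mulr_natl exprMn ltr_pM2r ?exprn_gt0//.
by have := d1; nra.
Qed.

Lemma grid_cell_sub x e a : 0 < e -> grid_cell x e a `<=` eball x (grid_radius e).
Proof.
move=> e0 u ua; rewrite /eball/= /grid_radius enorm_lt; last first.
  by rewrite !mulr_ge0// ltW.
apply: (@le_lt_trans _ _ (\sum_(i < d) (5 * d%:R * e) ^+ 2)).
  apply: ler_sum => i _; rewrite !mxE.
  have /andP[h1 h2] := ua i.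
  have a0 : 0 <= (a i)%:R :> R by [].
  have a8 : (a i)%:R <= 8 * d%:R :> R by rewrite -natrM ler_nat -ltnS.
  rewrite natrM in h1 h2.
  have ea0 : 0 <= e * (a i)%:R by rewrite mulr_ge0// ltW.
  have ea8 : e * (a i)%:R <= e * (8 * d%:R) by rewrite ler_pM2l.
  have eD : e * 1 <= e * d%:R by rewrite ler_pM2l.
  rewrite -real_normK ?num_real// ler_pXn2r// ?nnegrE// ?mulr_ge0// ?(ltW e0)//.
  by rewrite ler_norml; lra.
rewrite sumr_const card_ord -[ltLHS]mulr_natl.
have := d1; move: (d%:R : R) => D D1.
have e2 : 0 < e ^+ 2 by rewrite exprn_gt0.
have D3 : 1 <= D ^+ 3 by rewrite exprn_ege1.
rewrite (_ : D * _ = 25 * D ^+ 3 * e ^+ 2); last by ring.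
rewrite (_ : (16 * D ^+ 2 * e) ^+ 2 = 256 * D * D ^+ 3 * e ^+ 2); last by ring.
by rewrite ltr_pM2r//; nra.
Qed.

(* The Voronoi cell generated by S is star-shaped around x and avoids the sphere
   of radius 4de, so it lies inside, and points at distance at least 8de from x
   do not cut it. *)
Lemma voronoi_cell_local x e (S S' : set 'rV[R]_d) : 0 < e ->
  (forall a, exists2 u, S u & grid_cell x e a u) ->
  (forall s, S' s -> [\/ S s, s = x | grid_radius e <= enorm (s - x)]) ->
  voronoi_cell S x `<=` voronoi_cell S' x.
Proof.
move=> e0 Sgrid SS' p Sp.
have rho0 : 0 < 4 * d%:R * e by rewrite !mulr_gt0// ltr0n.
have px : enorm (p - x) < 4 * d%:R * e.
  rewrite ltNge; apply/negP => px.
  have px0 : 0 < enorm (p - x) by exact: lt_le_trans px.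
  pose t := 4 * d%:R * e / enorm (p - x).
  have t0 : 0 <= t by rewrite divr_ge0// ltW.
  pose q := x + t *: (p - x).
  have qx : enorm (q - x) = 4 * d%:R * e.
    by rewrite /q addrAC subrr add0r enormZ// divfK// gt_eqF.
  have Sq : voronoi_cell S x q.
    by apply: voronoi_cell_star => //; rewrite t0 ler_pdivrMr// mul1r.
  have [a qa] : exists a, grid_cell x e a q.
    apply: grid_cell_cover => // i; rewrite -qx.
    by have := coord_le_enorm (q - x) i; rewrite !mxE.
  have [u Su ua] := Sgrid a.
  have qu := grid_cell_diam e0 ua qa.
  (* A generator equal to the nucleus would give no constraint, but it is at distance exactly 4de
     from [q], too far to share a grid cell with it. *)
  have [ux|/eqP ux] := eqVneq u x; first by rewrite ux qx ltxx in qu.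
  by have := Sq u (conj Su ux); rewrite qx leNgt qu.
move=> s [S's sx]; have [Ss|//|xs] := SS' s S's; first exact: Sp.
rewrite -(@ler_pXn2r _ 2)// ?nnegrE ?enorm_ge0//.
have h1 := enormB_sqr s x p.
have h2 : enorm (p - x) ^+ 2 <= (4 * d%:R * e) ^+ 2.
  by rewrite ler_pXn2r// ?nnegrE ?enorm_ge0// ltW.
have h3 : (8 * d%:R * e) ^+ 2 <= enorm (s - x) ^+ 2.
  rewrite ler_pXn2r// ?nnegrE ?enorm_ge0// ?mulr_ge0// ?(ltW e0)//.
  by apply: le_trans xs; rewrite /grid_radius ler_pM2r//; have := d1; nra.
by nra.
Qed.

End grid.
Arguments grid_radius {R} d e.

(** * Masses near a Lebesgue point *)

Section lebesgue_point.
Context {R : realType} {d : nat} (d_gt0 : (0 < d)%N).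
Implicit Types (x : 'rV[R]_d) (f : 'rV[R]_d -> R).

Lemma measurable_eball x r : measurable (eball x r).
Proof.
rewrite (_ : eball x r = ~` [set v | r <= enorm (v - x)]); last first.
  by apply/seteqP; split=> v /=; rewrite /eball/= ltNge => /negP.
apply: measurableC; rewrite -[X in measurable X]setTI.
by apply: measurable_fun_le => //; exact: measurable_enormB.
Qed.

Lemma measurable_rV_box (a b : 'rV[R]_d) :
  measurable [set v : 'rV[R]_d | forall i, a ord0 i <= v ord0 i <= b ord0 i].
Proof.
rewrite (_ : mkset _ = \bigcap_(i in [set` finset.setT])
    ((fun v : 'rV[R]_d => v ord0 i) @^-1` `[a ord0 i, b ord0 i]%classic)).
  apply: fin_bigcap_measurable => // i _.
  by rewrite -[X in measurable X]setTI; exact: measurable_coord.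
apply/seteqP; split => v /= H i.
  by move=> _; rewrite /= in_itv /=; exact: H.
by have := H i (finset.in_setT i); rewrite /= in_itv.
Qed.

Lemma lebesgue_grid_cell x e a : 0 <= e ->
  lebesgue_rV (@grid_cell R d x e a) = (e ^+ d)%:E.
Proof.
move=> e0; pose l := \row_i (x ord0 i + e * ((a i)%:R - (4 * d)%:R)).
pose h := \row_i (x ord0 i + e * ((a i)%:R - (4 * d)%:R) + e).
rewrite (_ : grid_cell x e a =
    [set v | forall i, l ord0 i <= v ord0 i <= h ord0 i]); last first.
  by apply/seteqP; split=> v H i; have := H i; rewrite !mxE.
rewrite lebesgue_rV_box => [|i]; last by rewrite !mxE lerDl.
congr EFin; rewrite (eq_bigr (fun=> e)) ?prodr_const ?card_ord// => i _.
by rewrite !mxE addrAC subrr add0r.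
Qed.

Lemma lebesgue_eball_le x r : 0 <= r ->
  (lebesgue_rV (eball x r) <= ((2 * r) ^+ d)%:E)%E.
Proof.
move=> r0; pose l := \row_i (x ord0 i - r); pose h := \row_i (x ord0 i + r).
have lh i : l ord0 i <= h ord0 i by rewrite !mxE; lra.
apply: (@le_trans _ _ (lebesgue_rV
    [set v : 'rV[R]_d | forall i, l ord0 i <= v ord0 i <= h ord0 i])).
  apply: le_measure; rewrite ?inE; [exact: measurable_eball|exact: measurable_rV_box|].
  move=> v vx i; rewrite !mxE.
  have := le_lt_trans (coord_le_enorm (v - x) i) vx.
  by rewrite !mxE ltr_norml; lra.
rewrite lebesgue_rV_box// lee_fin (eq_bigr (fun=> 2 * r)) ?prodr_const ?card_ord//.
by move=> i _; rewrite !mxE; ring.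
Qed.

(** A grid cell occupies a fixed fraction of the volume of the ball, so a small mean deviation over
    the ball is still small against [f x] times the volume of a single grid cell. This gives the
    lower bound even though the cells are not balls centred at [x]. *)
Lemma lebesgue_point_masses f x : prob_density f -> Lebesgue_point f x ->
  0 < f x -> exists c C e0 : R, [/\ 0 < c, 0 < C, 0 < e0 &
    forall e, 0 < e < e0 ->
      (density_measure f (eball x (grid_radius d e)) <= (C * e ^+ d)%:E)%E /\
      (forall a, ((c * e ^+ d)%:E <= density_measure f (grid_cell x e a))%E)].
Proof.
move=> [mf f0 _] fx fx0.
(* [K * e ^+ d] is the volume of the cube circumscribed about the ball. *)
pose K : R := (2 * (16 * d%:R ^+ 2)) ^+ d.
have D0 : 0 < d%:R :> R by rewrite ltr0n.
have K0 : 0 < K by rewrite exprn_gt0// !mulr_gt0// exprn_gt0.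
(* The bound 1 gives the upper constant [(1 + f x) * K]. The other bound makes the total deviation
   over the ball at most [f x / 2 * e ^+ d], half of what a grid cell would carry at constant
   density [f x]. *)
pose E := Num.min 1 (f x / (2 * K)).
have E0 : 0 < E by rewrite lt_min ltr01 divr_gt0// mulr_gt0.
have E1 : E <= 1 by rewrite ge_min lexx.
have E2 : E * K <= f x / 2.
  rewrite -ler_pdivlMr// (_ : _ / K = f x / (2 * K)) ?ge_min ?lexx ?orbT//.
  by field; rewrite gt_eqF.
have [nfin /cvgrPdist_lt/(_ E E0) nlt] := (fine_cvgP _ _).1 fx.
have [r0 /= r00 nr0] := (nbhs_ballP _ _).1 (filterI nfin nlt).
have D2 : 0 < 16 * d%:R ^+ 2 :> R by rewrite mulr_gt0// exprn_gt0.
exists (f x / 2), ((1 + f x) * K), (r0 / (16 * d%:R ^+ 2)).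
split; rewrite ?divr_gt0 ?mulr_gt0 ?addr_gt0// => e /andP[e_gt0 er0].
pose r := grid_radius d e.
have r_gt0 : 0 < r by rewrite mulr_gt0.
have e0d : 0 < e ^+ d by rewrite exprn_gt0.
have mB : measurable (eball x r) := measurable_eball x r.
have mC a : measurable (grid_cell x e a) := measurable_grid_cell x e a.
have lamB : (lebesgue_rV (eball x r) <= (K * e ^+ d)%:E)%E.
  rewrite (_ : K * _ = (2 * r) ^+ d) ?lebesgue_eball_le ?ltW//.
  by rewrite /K -exprMn -mulrA.
have CB a : grid_cell x e a `<=` eball x r by exact: grid_cell_sub.
(* Positivity of the volume makes the extended-real inverse in [Lebesgue_point] an ordinary one. *)
have lamB_ge : ((e ^+ d)%:E <= lebesgue_rV (eball x r))%E.
  rewrite -(lebesgue_grid_cell x [ffun=> ord0] (ltW e_gt0)).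
  by apply: le_measure; rewrite ?inE//; exact: CB.
have mdiff : measurable_fun setT (fun u => `|f u - f x|).
  by apply: measurableT_comp => //; exact: measurable_funB.
have mEf D : measurable_fun D (EFin \o f).
  by apply: measurable_funS (subsetT _) _ => //; exact/measurable_EFinP.
have mEdiff D : measurable_fun D (fun u => `|f u - f x|%:E).
  by apply: measurable_funS (subsetT _) _ => //; exact/measurable_EFinP.
have mEsum D (g : 'rV[R]_d -> R) : measurable_fun setT g ->
    measurable_fun D (fun u => `|f u - f x|%:E + (g u)%:E)%E.
  move=> mg; apply: measurable_funS (subsetT _) _ => //.
  by apply/measurable_EFinP; exact: measurable_funD.
pose J := (\int[lebesgue_rV]_(u in eball x r) `|f u - f x|%:E)%E.
have J0 : (0 <= J)%E by apply: integral_ge0 => u _; rewrite lee_fin.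
have JE : (J <= (E * K * e ^+ d)%:E)%E.
  have := nr0 r; rewrite /ball/= sub0r normrN gtr0_norm//.
  rewrite {1}/r /grid_radius mulrC -ltr_pdivlMr// => /(_ er0 r_gt0)[].
  rewrite -/J; move: lamB lamB_ge J0.
  case: (lebesgue_rV _) => [l| |]//.
  rewrite !lee_fin => lK le J0.
  have l0 : 0 < l by exact: lt_le_trans le.
  rewrite inver gt_eqF//; case: J J0 => [j| |]//; last first.
    by rewrite gt0_muley// lte_fin invr_gt0.
  rewrite !lee_fin => j0 _; rewrite sub0r normrN/= ger0_norm; last first.
    by rewrite mulr_ge0// invr_ge0 ltW.
  rewrite ltr_pdivrMl// => /ltW/le_trans; apply.
  by rewrite mulrC -mulrA ler_pM2l.
split=> [|a].
- apply: (@le_trans _ _ (\int[lebesgue_rV]_(u in eball x r)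
      (`|f u - f x|%:E + (f x)%:E))%E).
    apply: ge0_le_integral => //.
    + by move=> u _; rewrite lee_fin.
    + exact: (mEsum _ (cst (f x)) (measurable_cst _)).
    + by move=> u _; rewrite lee_fin -lerBlDr ler_norm.
  rewrite ge0_integralD//; last by move=> u _; rewrite lee_fin ltW.
  rewrite integral_cst// (mulrDl 1) mulrDl EFinD leeD//.
    by apply: le_trans JE _; rewrite lee_fin mul1r ler_pM2r// ler_piMl// ltW.
  by rewrite -mulrA EFinM lee_pmul2l ?lte_fin.
(* [J] dominates the deviation over the cell. Adding it to both sides, which is licit because it is
   finite, replaces a subtraction of extended reals. *)
- rewrite -(@leeD2lE _ J); last by rewrite ge0_fin_numE// (le_lt_trans JE) ?ltry.
  apply: (@le_trans _ _ ((f x)%:E * lebesgue_rV (grid_cell x e a))%E).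
    rewrite lebesgue_grid_cell ?(ltW e_gt0)// -EFinM.
    apply: le_trans (leeD JE (lexx _)) _; rewrite -EFinD lee_fin -mulrDl ler_pM2r//.
    by lra.
  rewrite -integral_cst//.
  apply: (@le_trans _ _ (\int[lebesgue_rV]_(u in grid_cell x e a)
      (`|f u - f x|%:E + (f u)%:E))%E).
    apply: ge0_le_integral => //.
    + by move=> u _; rewrite lee_fin ltW.
    + exact: mEsum.
    + by move=> u _; rewrite lee_fin -lerBlDr distrC ler_norm.
  rewrite ge0_integralD//; last by move=> u _; rewrite lee_fin.
  by rewrite leeD2r// ge0_subset_integral// => u _; rewrite lee_fin.
Qed.

End lebesgue_point.

(** * Convergence in distribution from product test functions *)

Section interpolation.
Context {R : realType}.
Implicit Types y de : R.

Definition ramp y : R := Num.max 0 (Num.min 1 y).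

Lemma ramp01 y : 0 <= ramp y <= 1.
Proof. by rewrite /ramp le_max lexx/= ge_max ler01 ge_min lexx. Qed.

Lemma ramp0 y : y <= 0 -> ramp y = 0.
Proof.
by move=> y0; rewrite /ramp min_r ?max_l// (le_trans y0).
Qed.

Lemma ramp1 y : 1 <= y -> ramp y = 1.
Proof. by move=> y1; rewrite /ramp min_l// max_r. Qed.

Lemma ramp_homo y z : y <= z -> ramp y <= ramp z.
Proof.
move=> yz; rewrite /ramp ge_max le_max lexx/= le_max.
apply/orP; right; rewrite le_min ge_min lexx/= ge_min yz orbT//.
Qed.

Lemma continuous_ramp : continuous ramp.
Proof.
move=> y; apply: (@continuous_max R R (cst 0) (Num.min 1)).
  exact: cvg_cst.
by apply: (@continuous_min R R (cst 1) id); [exact: cvg_cst|exact: cvg_id].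
Qed.

Context (de : R) (N : nat) (de_gt0 : 0 < de).

Definition node (a : 'I_(2 * N).+1) : R := de * (a%:R - N%:R).

(* Piecewise linear interpolation at the nodes, with each hat function written
   as a difference of ramps so that their sum telescopes. *)
Definition hat (a : 'I_(2 * N).+1) y : R :=
  ramp (y / de - a%:R + N%:R + 1) - ramp (y / de - a%:R + N%:R).

Lemma hat01 a y : 0 <= hat a y <= 1.
Proof.
rewrite /hat subr_ge0 ramp_homo ?lerDl//=.
have /andP[_ h1] := ramp01 (y / de - a%:R + N%:R + 1).
by have /andP[h2 _] := ramp01 (y / de - a%:R + N%:R); lra.
Qed.

Lemma continuous_hat a : continuous (hat a).
Proof.
move=> y; apply: cvgB.
  apply: (@continuous_cvg _ _ _ _ _ _ ramp); first exact: continuous_ramp.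
  by do 3 (apply: cvgD; last exact: cvg_cst);
    apply: cvgM; [exact: cvg_id|exact: cvg_cst].
apply: (@continuous_cvg _ _ _ _ _ _ ramp); first exact: continuous_ramp.
by do 2 (apply: cvgD; last exact: cvg_cst);
    apply: cvgM; [exact: cvg_id|exact: cvg_cst].
Qed.

Lemma hat_support a y : hat a y != 0 -> `|y - node a| < de.
Proof.
apply: contraR; rewrite -leNgt => h.
have : 1 <= `|y / de - a%:R + N%:R|.
  rewrite (_ : _ + _ = (y - node a) / de); last by rewrite /node; field; rewrite gt_eqF.
  by rewrite normrM normfV (gtr0_norm de_gt0) ler_pdivlMr// mul1r.
rewrite ler_normr /hat => /orP[h1|h1].
  by rewrite !ramp1 ?subrr//; lra.
by rewrite !ramp0 ?subrr//; lra.
Qed.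

Lemma sum_hat y : \sum_a hat a y =
  ramp (y / de + N%:R + 1) - ramp (y / de - N%:R).
Proof.
pose g (i : nat) := - ramp (y / de - i%:R + N%:R + 1).
rewrite (eq_bigr (fun a : 'I__ => g a.+1 - g a)) => [|a _].
  rewrite -(big_mkord xpredT (fun i => g i.+1 - g i)) telescope_sumr// /g.
  rewrite opprK addrC subr0; congr (ramp _ - ramp _).
  by rewrite -natr1 natrM; ring.
by rewrite /g /hat opprK [RHS]addrC -[a.+1%:R]natr1; congr (_ - ramp _); ring.
Qed.

Lemma sum_hat01 y : 0 <= \sum_a hat a y <= 1.
Proof.
rewrite sum_hat subr_ge0 ramp_homo/=; last first.
  by have : 0 <= N%:R :> R by []; lra.
have /andP[_ h1] := ramp01 (y / de + N%:R + 1).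
by have /andP[h2 _] := ramp01 (y / de - N%:R); lra.
Qed.

Lemma sum_hat1 y : `|y| <= de * N%:R -> \sum_a hat a y = 1.
Proof.
rewrite ler_norml => /andP[h1 h2]; rewrite sum_hat ramp1 ?ramp0 ?subr0//.
  by rewrite subr_le0 ler_pdivrMr// mulrC.
rewrite lerDr -(ler_pM2r de_gt0) mul0r mulrDl divfK ?gt_eqF//; lra.
Qed.

Context {k : nat}.
Implicit Types (v : 'rV[R]_k) (h : 'rV[R]_k -> R).

Definition node_rV (a : {ffun 'I_k -> 'I_(2 * N).+1}) : 'rV[R]_k :=
  \row_j node (a j).

Definition interpolant h v : R :=
  \sum_(a : {ffun 'I_k -> 'I_(2 * N).+1})
    h (node_rV a) * \prod_j hat (a j) (v ord0 j).

(** The total weight of the interpolation at [v], by [plateauE]. It is 1 on the box spanned by the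
    nodes, so [1 - plateau v] measures escape from the box. Being a finite sum of products of
    one-variable functions, it is covered by the convergence hypothesis. *)
Definition plateau v : R := \prod_j \sum_a hat a (v ord0 j).

Lemma plateauE v : plateau v =
  \sum_(a : {ffun 'I_k -> 'I_(2 * N).+1}) \prod_j hat (a j) (v ord0 j).
Proof. exact: bigA_distr_bigA. Qed.

Lemma plateau01 v : 0 <= plateau v <= 1.
Proof.
apply: (big_ind (fun y => 0 <= y <= 1)) => [|y z|j _]; last exact: sum_hat01.
  by rewrite ler01 lexx.
by move=> /andP[y0 y1] /andP[z0 z1]; rewrite mulr_ge0//= mulr_ile1.
Qed.

(** Nodes with nonzero weight are within [de] of [v] in each coordinate and contribute at most [e]
    in total; the missing weight [1 - plateau v] is charged to the bound [H]. *)
Lemma interpolant_error h H v e : (forall s, `|h s| <= H) -> 0 <= e ->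
  (forall a : {ffun _}, (forall j, `|v ord0 j - node (a j)| < de) ->
    `|h v - h (node_rV a)| <= e) ->
  `|h v - interpolant h v| <= e + H * (1 - plateau v).
Proof.
move=> hH e0 he.
have hat_ge0 (a : {ffun 'I_k -> 'I_(2 * N).+1}) : 0 <= \prod_j hat (a j) (v ord0 j).
  by apply: prodr_ge0 => j _; have /andP[] := hat01 (a j) (v ord0 j).
have /andP[p0 p1] := plateau01 v.
have -> : h v - interpolant h v =
  \sum_(a : {ffun 'I_k -> 'I_(2 * N).+1})
    (h v - h (node_rV a)) * \prod_j hat (a j) (v ord0 j) + h v * (1 - plateau v).
  under eq_bigr do rewrite mulrBl.
  by rewrite sumrB -mulr_sumr -plateauE /interpolant; ring.
rewrite (le_trans (ler_normD _ _))// lerD//; last first.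
  by rewrite normrM (ger0_norm (_ : 0 <= 1 - _)) ?subr_ge0// ler_wpM2r ?subr_ge0.
apply: (@le_trans _ _ (e * plateau v)); last by rewrite ler_piMr.
rewrite plateauE mulr_sumr (le_trans (ler_norm_sum _ _ _))// ler_sum// => a _.
rewrite normrM (ger0_norm (hat_ge0 a)).
have [->|/prodf_neq0 hneq0] := eqVneq (\prod_j hat (a j) (v ord0 j)) 0.
  by rewrite !mulr0.
by rewrite ler_wpM2r// he// => j; apply: hat_support; exact: hneq0.
Qed.

End interpolation.

Section product_test_functions.
Context {R : realType} {k : nat}.
Implicit Types (h : 'rV[R]_k -> R).

(** Only [q] is confined to the compact box: it will be an interpolation node, while [y] is an
    arbitrary nearby value. *)
Lemma continuous_uniform_box h (T e : R) : continuous h -> 0 < e ->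
  exists2 de : R, 0 < de & forall q : 'rV[R]_k, (forall j, `|q ord0 j| <= T) ->
    forall y : 'rV[R]_k, (forall j, `|y ord0 j - q ord0 j| < de) ->
    `|h y - h q| <= e.
Proof.
move=> ch e0.
pose K := [set v : 'rV[R]_k | forall j, `[-T, T]%classic (v ord0 j)].
have cK : compact K.
  by apply: (@rV_compact R k (fun=> `[-T, T]%classic)) => j; apply: segment_compact.
have /compact_near_coveringP covK := cK.
pose Q (de : R) (q : 'rV[R]_k) := forall y : 'rV[R]_k,
  (forall j, `|y ord0 j - q ord0 j| < de) -> `|h y - h q| <= e.
have near_Q x : K x -> \forall x' \near x & de \near (0:R)^'+, Q de x'.
  move=> Kx.
  have e2 : 0 < e / 2 by rewrite divr_gt0.
  have /cvgrPdist_lt/(_ _ e2)/nbhs_ballP[r /= r0 hr] := ch x.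
  have r2 : 0 < r / 2 by rewrite divr_gt0.
  have hr' (z : 'rV[R]_k) : (forall j, `|x ord0 j - z ord0 j| < r) ->
      `|h x - h z| < e / 2.
    by move=> xz; apply: hr; split => // i j; rewrite (ord1 i); exact: xz.
  exists (ball x (r / 2), [set de | de < r / 2]).
    split => /=; first exact: nbhsx_ballx.
    exact: nbhs_right_lt.
  move=> [q de] /= [[_ xq] de_r] y yq.
  have xq' j : `|x ord0 j - q ord0 j| < r / 2 by exact: xq.
  rewrite (_ : h y - h q = (h x - h q) - (h x - h y)); last by ring.
  rewrite (le_trans (ler_normB _ _))// [leRHS](splitr e) lerD// ltW// hr'// => j.
    by apply: lt_trans (xq' j) _; lra.
  rewrite (_ : _ - _ = (x ord0 j - q ord0 j) - (y ord0 j - q ord0 j)); last by ring.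
  rewrite (le_lt_trans (ler_normB _ _))// [ltRHS](splitr r) ltrD//.
  exact: lt_trans (yq j) de_r.
have [r0 /= r00 hr0] := (nbhs_ballP _ _).1 (covK _ _ _ _ near_Q).
exists (r0 / 2); first by rewrite divr_gt0.
move=> q qT; have r2 : 0 < r0 / 2 by rewrite divr_gt0.
apply: (hr0 (r0 / 2)) => //.
  by rewrite /ball/= sub0r normrN gtr0_norm//; lra.
by move=> j; rewrite /= in_itv/= -ler_norml.
Qed.

Lemma bounded_measurable_hats {dO} {O : measurableType dO} (Y : O -> 'rV[R]_k)
    (de : R) N (a : {ffun 'I_k -> 'I_(2 * N).+1}) : 0 < de ->
  measurable_fun setT Y ->
  bounded_measurable (fun w => \prod_j hat de (a j) (Y w ord0 j)).
Proof.
move=> de0 /measurable_fun_rVP mY; apply: bounded_measurable_prod => j.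
apply: bounded_measurable01; last by move=> w; exact: hat01.
exact: (measurableT_comp (continuous_measurable_fun (@continuous_hat _ de N (a j)))
  (mY j)).
Qed.

Lemma bounded_measurable_interpolant {dO} {O : measurableType dO}
    (Y : O -> 'rV[R]_k) h (de : R) (N : nat) : 0 < de -> measurable_fun setT Y ->
  bounded_measurable (fun w => interpolant de N h (Y w)).
Proof.
move=> de0 mY; apply: bounded_measurable_sum => a; apply: bounded_measurableM.
  exact: bounded_measurable_cst.
exact: bounded_measurable_hats.
Qed.

Lemma bounded_measurable_plateau {dO} {O : measurableType dO}
    (Y : O -> 'rV[R]_k) (de : R) (N : nat) : 0 < de -> measurable_fun setT Y ->
  bounded_measurable (fun w => plateau de N (Y w)).
Proof.
move=> de0 mY; under eq_fun do rewrite plateauE.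
by apply: bounded_measurable_sum => a; exact: bounded_measurable_hats.
Qed.

Lemma plateau1 (de : R) N (v : 'rV[R]_k) : 0 < de ->
  (forall j, `|v ord0 j| <= de * N%:R) -> plateau de N v = 1.
Proof. by move=> de0 vN; rewrite /plateau big1// => j _; rewrite sum_hat1. Qed.

(** The sigma-algebra on row vectors is generated by the coordinates, so measurability is obtained
    by writing [h] as a pointwise limit of interpolants, which are built from functions of single
    coordinates. *)
Lemma bounded_measurable_continuous_comp {dO} {O : measurableType dO}
    (Y : O -> 'rV[R]_k) h (H : R) : continuous h -> (forall s, `|h s| <= H) ->
  measurable_fun setT Y -> bounded_measurable (h \o Y).
Proof.
move=> ch hH mY; split; last by exists H => w; exact: hH.
(* With mesh [1 / (n + 1)] and [(n + 1)^2] nodes on each side of 0, the box reaches [n + 1]: the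
   mesh shrinks while the boxes exhaust the space. *)
pose de n : R := n.+1%:R^-1.
have de0 n : 0 < de n by rewrite invr_gt0.
apply: (@measurable_fun_cvg _ _ _ _ (fun n w => interpolant (de n) (n.+1 ^ 2) h (Y w))).
  move=> n.
  by have [] := @bounded_measurable_interpolant _ _ Y h _ (n.+1 ^ 2) (de0 n) mY.
move=> w _; apply/cvgrPdist_le => e e0.
pose T := \sum_j `|Y w ord0 j|.
have YT j : `|Y w ord0 j| <= T by rewrite /T (bigD1 j)//= lerDl sumr_ge0.
have /cvgrPdist_lt/(_ _ e0)/nbhs_ballP[r /= r0 hr] := ch (Y w).
near=> n; have Tn : T <= n.+1%:R.
  by apply: (@le_trans _ _ n%:R); [near: n; exact: nbhs_infty_ger|rewrite ler_nat].
have der : de n < r by near: n; exact: (near_infty_natSinv_lt (PosNum r0)).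
have deN : de n * (n.+1 ^ 2)%:R = n.+1%:R.
  by rewrite natrX expr2 mulrA mulVf ?mul1r.
have YdeN j : `|Y w ord0 j| <= de n * (n.+1 ^ 2)%:R by rewrite deN (le_trans (YT j)).
have := @interpolant_error _ _ (n.+1 ^ 2) (de0 n) _ h H (Y w) e hH (ltW e0).
rewrite plateau1// subrr mulr0 addr0; apply => a Ya; apply/ltW/hr.
split => // i j; rewrite (ord1 i) mxE; exact: lt_trans (Ya j) der.
Unshelve. all: by end_near. Qed.

(** Tightness of a single law, expressed with [plateau] instead of the indicator of a box because
    the mean of [plateau] passes to the limit. *)
Lemma plateau_tight {dO} {O : measurableType dO} (P : probability O R)
    (Z : O -> 'rV[R]_k) (e : R) : measurable_fun setT Z -> 0 < e ->
  exists2 T : R, 0 < T & forall (de : R) N, 0 < de -> T <= de * N%:R ->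
    1 - e <= mean P (fun w => plateau de N (Z w)).
Proof.
move=> /[dup] mZ /measurable_fun_rVP mZj e0.
pose A (n : nat) : set O := [set w | forall j, `|Z w ord0 j| <= n%:R].
have mA n : measurable (A n).
  rewrite (_ : A n = \bigcap_(j in [set` finset.setT]) [set w | `|Z w ord0 j| <= n%:R]).
    apply: fin_bigcap_measurable => // j _.
    rewrite -[X in measurable X]setTI; apply: measurable_fun_le => //.
    exact: measurableT_comp (mZj j).
  apply/seteqP; split=> w /= Hw j; first by move=> _; exact: Hw.
  exact/Hw/finset.in_setT.
have UA : \bigcup_n A n = setT.
  apply/seteqP; split => // w _.
  pose T := \sum_j `|Z w ord0 j|.
  exists (Num.truncn T).+1 => // j; apply: (@le_trans _ _ T).
    by rewrite /T (bigD1 j)//= lerDl sumr_ge0.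
  by rewrite ltW// truncnS_gt.
have cvgA : P (A n) @[n --> \oo] --> P setT.
  rewrite -UA; apply: nondecreasing_cvg_mu => //; first by rewrite UA.
  move=> m n mn; apply/subsetPset => w /= Aw j.
  by rewrite (le_trans (Aw j))// ler_nat.
move: cvgA; rewrite probability_setT => /fine_cvgP[_ /cvgrPdist_lt/(_ _ e0)] [m _ hm].
exists m.+1%:R => // de N de0 TN.
have := hm m.+1 (leqnSn m); rewrite /= ltr_norml => /andP[_ h1].
apply: (@le_trans _ _ (fine (P (A m.+1)))); first by lra.
rewrite -mean_indic//; apply: le_mean.
- exact: bounded_measurable_indic.
- exact: bounded_measurable_plateau.
move=> w; rewrite indicE; have [/set_mem Aw|_] := boolP (w \in A m.+1).
  by rewrite plateau1// => j; rewrite (le_trans (Aw j)).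
by have /andP[] := plateau01 de N (Z w).
Qed.

(** Both [interpolant] and [plateau] are finite combinations of product test functions, so their
    means converge. The first handles [h] on a large box; the second transfers tightness from [Z] to
    [Y n]. *)
Lemma cvg_in_distribution_rV {dO dO'} {O : measurableType dO}
    {O' : measurableType dO'} (P : probability O R) (Q : probability O' R)
    (Y : nat -> O -> 'rV[R]_k) (Z : O' -> 'rV[R]_k) :
  (forall n, measurable_fun setT (Y n)) -> measurable_fun setT Z ->
  (forall phi : 'I_k -> R -> R, (forall j, continuous (phi j)) ->
    (forall j y, 0 <= phi j y <= 1) ->
    mean P (fun w => \prod_j phi j (Y n w ord0 j)) @[n --> \oo] -->
    mean Q (fun w => \prod_j phi j (Z w ord0 j))) ->
  cvg_in_distribution P Y Q Z.
Proof.
move=> mY mZ cvg_phi h ch [M hM].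
pose H := `|M| + 1.
have H0 : 0 < H by rewrite ltr_wpDl.
have hH s : `|h s| <= H.
  by rewrite (le_trans (hM s))// /H (le_trans (ler_norm M))// lerDl.
have bY n := @bounded_measurable_continuous_comp _ _ (Y n) h H ch hH (mY n).
have bZ := bounded_measurable_continuous_comp ch hH mZ.
rewrite (expectation_mean Q bZ).
under eq_cvg do rewrite (expectation_mean P (bY _)).
apply/cvg_EFin; first by near=> n.
apply/cvgrPdist_le => e e0.
(* Interpolation will cost 3/8 of [e] under [Y n] and 2/8 under [Z], and the interpolants differ by
   1/8 in mean: 6/8 in all. *)
have e8 : 0 < e / 8 by rewrite divr_gt0.
have eH : 0 < e / 8 / H by rewrite divr_gt0.
have [T T0 tight] := plateau_tight Q mZ eH.
have [de' de'0 unif] := @continuous_uniform_box h T _ ch e8.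
(* The nodes end exactly at [T], where tightness holds, and their spacing [T / N] is below the
   modulus [de']. *)
pose N := (Num.truncn (T / de')).+1.
have N0 : 0 < N%:R :> R by rewrite ltr0n.
pose de := T / N%:R.
have de0 : 0 < de by rewrite divr_gt0.
have deN : de * N%:R = T by rewrite divfK// gt_eqF.
have dede' : de < de'.
  by rewrite ltr_pdivrMr// mulrC -ltr_pdivrMr// /N truncnS_gt.
have err v : `|h v - interpolant de N h v| <= e / 8 + H * (1 - plateau de N v).
  apply: interpolant_error => //; first exact: ltW.
  move=> a va; apply: unif => j; rewrite mxE; last exact: lt_trans (va j) dede'.
  rewrite /node -deN normrM gtr0_norm// ler_pM2l// ler_norml.
  have : (a j)%:R <= 2 * N%:R :> R by rewrite -natrM ler_nat -ltnS.
  by have : 0 <= (a j)%:R :> R by []; lra.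
have mean_err d1 (O1 : measurableType d1) (P1 : probability O1 R)
    (Y1 : O1 -> 'rV[R]_k) :
    measurable_fun setT Y1 -> bounded_measurable (h \o Y1) ->
    `|mean P1 (h \o Y1) - mean P1 (fun w => interpolant de N h (Y1 w))| <=
    e / 8 + H * (1 - mean P1 (fun w => plateau de N (Y1 w))).
  move=> mY1 bY1.
  have bpl := @bounded_measurable_plateau _ _ Y1 de N de0 mY1.
  have bcst c := @bounded_measurable_cst R _ O1 c.
  have bpl' := bounded_measurableB (bcst 1) bpl.
  have bHpl := bounded_measurableM (bcst H) bpl'.
  have -> : e / 8 + H * (1 - mean P1 (fun w => plateau de N (Y1 w))) =
      mean P1 (fun w => e / 8 + H * (1 - plateau de N (Y1 w))).
    by rewrite meanD// mean_cst meanZ// meanB// mean_cst.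
  apply: mean_dist => //; first exact: bounded_measurable_interpolant.
  - by apply: bounded_measurableD => //; exact: bcst.
  - by move=> w; exact: err.
have cvg_hats (a : {ffun 'I_k -> 'I_(2 * N).+1}) :
    mean P (fun w => \prod_j hat de (a j) (Y n w ord0 j)) @[n --> \oo] -->
    mean Q (fun w => \prod_j hat de (a j) (Z w ord0 j)).
  by apply: (cvg_phi (fun j => hat de (a j))) => [j|j y];
    [exact: continuous_hat|exact: hat01].
have bhats d1 (O1 : measurableType d1) (Y1 : O1 -> 'rV[R]_k)
    (a : {ffun 'I_k -> 'I_(2 * N).+1}) c :
    measurable_fun setT Y1 ->
    bounded_measurable (fun w => c * \prod_j hat de (a j) (Y1 w ord0 j)).
  move=> mY1; apply: bounded_measurableM; first exact: bounded_measurable_cst.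
  exact: bounded_measurable_hats.
have cvg_comb (c : {ffun 'I_k -> 'I_(2 * N).+1} -> R) :
    mean P (fun w => \sum_a c a * \prod_j hat de (a j) (Y n w ord0 j)) @[n --> \oo] -->
    mean Q (fun w => \sum_a c a * \prod_j hat de (a j) (Z w ord0 j)).
  have mean_comb d1 (O1 : measurableType d1) (P1 : probability O1 R)
      (Y1 : O1 -> 'rV[R]_k) : measurable_fun setT Y1 ->
      mean P1 (fun w => \sum_a c a * \prod_j hat de (a j) (Y1 w ord0 j)) =
      \sum_a c a * mean P1 (fun w => \prod_j hat de (a j) (Y1 w ord0 j)).
    move=> mY1; rewrite mean_sum => [|a]; last exact: bhats.
    by apply: eq_bigr => a _; rewrite meanZ//; exact: bounded_measurable_hats.
  rewrite (mean_comb _ _ Q Z mZ); under eq_cvg do rewrite (mean_comb _ _ P _ (mY _)).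
  apply: (@cvg_big R) => [|a _]; first exact: add_continuous.
  by apply: cvgM; [exact: cvg_cst|exact: cvg_hats].
have /cvgrPdist_le/(_ _ e8) cvg_int := cvg_comb (fun a => h (node_rV de a)).
have /cvgrPdist_le/(_ _ eH) cvg_pl := cvg_comb (fun=> 1).
have plE (O1 : Type) (Y1 : O1 -> 'rV[R]_k) :
  (fun w => \sum_(a : {ffun 'I_k -> 'I_(2 * N).+1})
    1 * \prod_j hat de (a j) (Y1 w ord0 j)) = (fun w => plateau de N (Y1 w)).
  by apply/funext => w; rewrite plateauE; apply: eq_bigr => a _; rewrite mul1r.
have plZ : 1 - e / 8 / H <= mean Q (fun w => plateau de N (Z w)).
  by apply: tight => //; rewrite deN.
near=> n.
have h1 := mean_err _ _ P (Y n) (mY n) (bY n).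
have h2 := mean_err _ _ Q Z mZ bZ.
have h3 : `|mean Q (fun w => interpolant de N h (Z w)) -
   mean P (fun w => interpolant de N h (Y n w))| <= e / 8 by near: n; exact: cvg_int.
have h4 : `|mean Q (fun w => plateau de N (Z w)) -
   mean P (fun w => plateau de N (Y n w))| <= e / 8 / H.
  by rewrite -!plE; near: n; exact: cvg_pl.
have h5 : H * (1 - mean Q (fun w => plateau de N (Z w))) <= e / 8.
  by rewrite mulrC -ler_pdivlMr//; lra.
have h6 : H * (1 - mean P (fun w => plateau de N (Y n w))) <= e / 8 + e / 8.
  rewrite -mulr2n -[leRHS]mulr_natl mulrC -ler_pdivlMr// -mulrA.
  by move: h4; rewrite ler_norml => /andP[]; lra.
move: h1 h2 h3; rewrite !ler_norml => /andP[? ?] /andP[? ?] /andP[? ?].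
by rewrite /=; apply/andP; split; lra.
Unshelve. all: by end_near. Qed.

End product_test_functions.

(** * Asymptotic independence of the cell masses *)

Section retraction.
Context {R : realType} {d : nat}.
Implicit Types (x u : 'rV[R]_d) (A U : set 'rV[R]_d).

(* Discards a sample point outside the ball: the nucleus itself imposes no
   constraint on its cell. *)
Definition retract x (r : R) u : 'rV[R]_d := if enorm (u - x) < r then u else x.

Lemma measurable_retract x r : measurable_fun setT (retract x r).
Proof.
apply: measurable_fun_ifT => //.
by apply: measurable_fun_ltr => //; exact: measurable_enormB.
Qed.

(** [U] stands for the nuclei, either all of them or [x] alone, and [A] for the sample. Retracted
    points other than [x] already belong to [A], which gives one inclusion. The other is locality,
    since points in the grid cells lie in the ball and survive the retraction. *)
Lemma voronoi_cell_retract (d_gt0 : (0 < d)%N) x (e : R) U A : 0 < e ->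
  (forall s, U s -> s = x \/ grid_radius d e <= enorm (s - x)) ->
  (forall a, exists2 u, A u & grid_cell x e a u) ->
  voronoi_cell (U `|` A) x =
  voronoi_cell ([set x] `|` retract x (grid_radius d e) @` A) x.
Proof.
move=> e0 Ux gridA; apply/seteqP; split.
  move=> p Sp s [[->|[u Au <-]] sx]; first by [].
  move: sx; rewrite /retract; case: ifP => // _ ux.
  by apply: Sp; split=> //; right.
apply: (voronoi_cell_local d_gt0 e0) => [a|s].
  have [u Au ua] := gridA a; exists u => //; right; exists u => //.
  by rewrite /retract; have := grid_cell_sub d_gt0 e0 ua; rewrite /eball/= => ->.
case=> [/Ux[->|xs]|As]; [by constructor 2|by constructor 3|].
have [sr|rs] := ltP (enorm (s - x)) (grid_radius d e); last by constructor 3.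
by constructor 1; right; exists s => //; rewrite /retract sr.
Qed.

End retraction.

(** The product [(1 - q) ^+ n * (1 + n%:R * q)] does not increase with [n]. Decay in [1 / (n q)]
    suffices, since [n q] will be a multiple of the freely chosen constant K. *)
Lemma expr_onem_le {R : realType} (q : R) n : 0 <= q <= 1 ->
  (1 - q) ^+ n <= (1 + n%:R * q)^-1.
Proof.
move=> /andP[q0 q1]; have den0 m : 0 < 1 + m%:R * q by rewrite ltr_pwDl// mulr_ge0.
rewrite -[leRHS]mul1r ler_pdivlMr//; elim: n => [|n IHn].
  by rewrite expr0 !mul1r mul0r addr0.
apply: le_trans IHn; rewrite exprSr -mulrA ler_wpM2l ?exprn_ge0 ?subr_ge0//.
rewrite -natr1; have : 0 <= n%:R :> R by []; nra.
Qed.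

Lemma prodr_dist01 {R : realType} (J : Type) (s : seq J) (b c : J -> R) (e : R) :
  (forall j, 0 <= b j <= 1) -> (forall j, 0 <= c j <= 1) ->
  (forall j, `|b j - c j| <= e) ->
  `|\prod_(j <- s) b j - \prod_(j <- s) c j| <= (size s)%:R * e.
Proof.
move=> b01 c01 bc; elim: s => [|j s IHs].
  by rewrite !big_nil subrr normr0 mul0r.
rewrite !big_cons -natr1 mulrDl mul1r.
have /andP[b0 b1] := b01 j.
have /andP[p0 p1] : 0 <= \prod_(i <- s) c i <= 1 by exact: prod01.
rewrite (_ : _ - _ = b j * (\prod_(i <- s) b i - \prod_(i <- s) c i) +
  (b j - c j) * \prod_(i <- s) c i); last by ring.
rewrite (le_trans (ler_normD _ _))// lerD// normrM.
  by rewrite (ger0_norm b0); apply: le_trans IHs; rewrite ler_piMl.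
by rewrite (ger0_norm p0); apply: le_trans (bc j); rewrite ler_piMr.
Qed.

Lemma size_index_enum (T : finType) : size (index_enum T) = #|T|.
Proof.
rewrite -(card_uniqP (index_enum_uniq T)); apply: eq_card => i.
by rewrite mem_index_enum.
Qed.

Section decoupling.
Context {R : realType} {d k n : nat} (d_gt0 : (0 < d)%N) {dX}
  {OX : measurableType dX} {P : probability OX R}
  (X : nat -> {RV P >-> 'rV[R]_d}) (indX : mutually_independent X)
  (f : 'rV[R]_d -> R) (f_density : prob_density f) (x : 'I_k -> 'rV[R]_d)
  (e p q : R) (e_gt0 : 0 < e).
Local Notation r := (grid_radius d e).
Context (x_sep : forall i j, i != j -> 2 * r <= enorm (x i - x j))
  (ball_le : forall i j, fine (P (X i @^-1` eball (x j) r)) <= p)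
  (cell_ge : forall i j a, q <= fine (P (X i @^-1` grid_cell (x j) e a))).

Let indices : n.-tuple nat := [tuple (i : nat) | i < n].

Let uniq_indices : uniq indices.
Proof. by rewrite map_inj_uniq ?enum_uniq//; exact: val_inj. Qed.

Let local_sample j (t : n.-tuple 'rV[R]_d) : set 'rV[R]_d :=
  [set x j] `|` [set retract (x j) r (tnth t i) | i in [set: 'I_n]].

(** A function of the tuple of sample points, as the covariance bound requires. Off [bad] it equals
    the cell mass of [x j] both in the joint diagram and in the diagram with the single nucleus
    [x j]. *)
Let local_mass j (t : n.-tuple 'rV[R]_d) : R :=
  n%:R * fine (density_measure f (voronoi_cell (local_sample j t) (x j))).

(** The space of tuples, under the law of the sample, is itself taken as a probability space:
    [local_mass j] is then a [scaled_cell_mass] for the retracted coordinates. The default [x j]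
    extends these to an infinite sequence, of which only the first [n] terms matter. *)
Let measurable_local_mass j : measurable_fun setT (local_mass j).
Proof.
pose Y (i : nat) (t : n.-tuple 'rV[R]_d) := retract (x j) r (nth (x j) t i).
have mY i : measurable_fun setT (Y i).
  apply: measurableT_comp; first exact: measurable_retract.
  have [i_n|n_i] := ltnP i n; last first.
    rewrite (_ : (fun _ => _) = cst (x j))//; apply/funext => t.
    by rewrite nth_default ?size_tuple.
  rewrite (_ : (fun _ => _) = (fun t => tnth t (Ordinal i_n))); last first.
    by apply/funext => t; rewrite (tnth_nth (x j)).
  exact: measurable_tnth.
pose P' : probability _ R := distribution P (tuple_map X indices).
pose Ym i : {RV P' >-> 'rV[R]_d} := mfun_Sub (mem_set (mY i) : Y i \in mfun).
rewrite (_ : local_mass j = scaled_cell_mass f Ym [set x j] (x j) n).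
  exact: measurable_scaled_cell_mass.
apply/funext => t; rewrite /local_mass /scaled_cell_mass /local_sample /sample.
congr (_ * fine (density_measure f (voronoi_cell (_ `|` _) (x j)))).
apply/seteqP; split=> u [i /= i_n <-].
  by exists i => //=; rewrite /Y -tnth_nth.
by exists (Ordinal i_n) => //; rewrite /Y (tnth_nth (x j)).
Qed.

Let depends_on_local_mass j : depends_on (eball (x j) r) (local_mass j).
Proof.
move=> t t' tt'; have tE i : retract (x j) r (tnth t i) = retract (x j) r (tnth t' i).
  have [->//|[]] := tt' i; rewrite /eball/= /retract.
  by move=> /negP/negbTE-> /negP/negbTE->.
rewrite /local_mass /local_sample.
congr (_ * fine (density_measure f (voronoi_cell (_ `|` _) (x j)))).
by apply/seteqP; split=> u [i _ <-]; exists i.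
Qed.

Let missed (ja : 'I_k * {ffun 'I_d -> 'I_(8 * d).+1}) : set OX :=
  [set w | forall i, (i < n)%N -> ~ grid_cell (x ja.1) e ja.2 (X i w)].

Let measurable_missed ja : measurable (missed ja).
Proof.
rewrite (_ : missed ja =
    \bigcap_(i in `I_n) X i @^-1` ~` grid_cell (x ja.1) e ja.2)//.
apply: fin_bigcap_measurable => // i _.
apply: measurable_funPTI.
by apply: measurableC; exact: measurable_grid_cell.
Qed.

Let bad : set OX := \big[setU/set0]_ja missed ja.

Let measurable_bad : measurable bad.
Proof. exact: bigsetU_measurable. Qed.

Let bad_le : fine (P bad) <=
  (k * #|{ffun 'I_d -> 'I_(8 * d).+1}|)%:R * (1 - q) ^+ n.
Proof.
have -> : (k * #|{ffun 'I_d -> 'I_(8 * d).+1}|)%N =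
    size (index_enum ('I_k * {ffun 'I_d -> 'I_(8 * d).+1})%type).
  by rewrite size_index_enum card_prod card_ord.
apply: probability_bigsetU_le => // ja.
apply: probability_miss => //; exact: measurable_grid_cell.
Qed.

Let local_massE U j w : ~ bad w ->
  (forall s, U s -> s = x j \/ r <= enorm (s - x j)) ->
  scaled_cell_mass f X U (x j) n w = local_mass j (tuple_map X indices w).
Proof.
move=> w_bad Ux; rewrite /scaled_cell_mass /local_mass /local_sample.
rewrite (voronoi_cell_retract d_gt0 e_gt0 Ux).
  congr (_ * fine (density_measure f (voronoi_cell (_ `|` _) (x j)))).
  apply/seteqP; split=> u.
    move=> [_ [i /= i_n <-] <-]; exists (Ordinal i_n) => //.
    by rewrite tnth_map tnth_mktuple.
  move=> [i _ <-]; rewrite tnth_map tnth_mktuple.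
  by exists (X i w) => //; exists i => //=.
move=> a; apply: contrapT => h; apply: w_bad; rewrite /bad -bigcup_seq.
exists (j, a); first by rewrite /= mem_index_enum.
by move=> i i_n ia; apply: h; exists (X i w) => //; exists i.
Qed.

(** The event [bad] is paid for [k.+1] times: once to make all joint masses local, and once for each
    of the [k] factors on the way back to single-nucleus masses. It is itself a union over [k]
    nuclei and all their grid cells. *)
Lemma scaled_cell_mass_decoupling (phi : 'I_k -> R -> R) :
  (forall j, measurable_fun setT (phi j)) -> (forall j y, 0 <= phi j y <= 1) ->
  `|mean P (fun w => \prod_j phi j (scaled_cell_mass f X (range x) (x j) n w)) -
    \prod_j mean P (phi j \o scaled_cell_mass f X [set x j] (x j) n)| <=
  (k.+1 * k * #|{ffun 'I_d -> 'I_(8 * d).+1}|)%:R * (1 - q) ^+ n +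
  n%:R * k%:R ^+ 2 * p ^+ 2.
Proof.
move=> mphi phi01.
have r_gt0 : 0 < r by rewrite /grid_radius mulr_gt0// mulr_gt0// exprn_gt0// ltr0n.
pose V := tuple_map X indices.
have mM U j : finite_set U ->
    measurable_fun setT (phi j \o scaled_cell_mass f X U (x j) n).
  by move=> fU; apply: measurableT_comp => //; exact: measurable_scaled_cell_mass.
have mL j : measurable_fun setT (phi j \o local_mass j).
  by apply: measurableT_comp.
have mLV j : measurable_fun setT (phi j \o local_mass j \o V).
  exact: (measurableT_comp (mL j) (measurable_tuple_map X _)).
have frange : finite_set (range x) by exact: finite_image.
pose eps := fine (P bad).
have step1 : `|mean P (fun w =>
      \prod_j phi j (scaled_cell_mass f X (range x) (x j) n w)) -
    mean P (fun w => \prod_j (phi j \o local_mass j) (V w))| <= eps.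
  apply: mean_dist_off => //.
  - by apply: measurable_prod => j _; exact: (mM (range x) j).
  - by apply: measurable_prod => j _; exact: (mLV j).
  - by move=> w; exact: prod01.
  - by move=> w; apply: prod01 => j; exact: phi01.
  move=> w w_bad; apply: eq_bigr => j _ /=; rewrite local_massE// => _ [i _ <-].
  have [->|ij] := eqVneq i j; [by left|right].
  by apply: le_trans (x_sep ij); lra.
have step2 : `|mean P (fun w => \prod_j (phi j \o local_mass j) (V w)) -
    \prod_j mean P ((phi j \o local_mass j) \o V)| <= n%:R * k%:R ^+ 2 * p ^+ 2.
  have := @tuple_decoupling _ _ _ _ _ _ P X _ (index_enum 'I_k)
    (fun j => eball (x j) r) p n indices (fun j => phi j \o local_mass j).
  rewrite size_index_enum card_ord; apply => //.
  - exact: index_enum_uniq.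
  - by move=> j; exact: measurable_eball.
  - move=> i j ij; apply/seteqP; split=> // u [ui uj].
    have := enormB_sqr (x i) (x j) u; have := x_sep ij.
    move: ui uj; rewrite /eball/= => ui uj.
    have := enorm_ge0 (u - x i); have := enorm_ge0 (u - x j); nra.
  - by move=> j t; exact: phi01.
  - by move=> j t t' tt'; rewrite /= (depends_on_local_mass tt').
have step3 : `|\prod_j mean P ((phi j \o local_mass j) \o V) -
    \prod_j mean P (phi j \o scaled_cell_mass f X [set x j] (x j) n)| <= k%:R * eps.
  rewrite -[X in X%:R * _](card_ord k) -size_index_enum.
  apply: prodr_dist01 => j.
  - by apply: mean01 => // w; exact: phi01.
  - by apply: mean01 => [|w]; [exact: mM|exact: phi01].
  apply: mean_dist_off => //.
  - exact: mM.
  - by move=> w; exact: phi01.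
  - by move=> w; exact: phi01.
  by move=> w w_bad /=; rewrite (local_massE w_bad) => // s ->; left.
have eps_le : k.+1%:R * eps <=
    (k.+1 * k * #|{ffun 'I_d -> 'I_(8 * d).+1}|)%:R * (1 - q) ^+ n.
  by rewrite -mulnA natrM -mulrA ler_wpM2l.
apply: (@le_trans _ _ (eps + (n%:R * k%:R ^+ 2 * p ^+ 2 + k%:R * eps))).
  rewrite (le_trans (ler_distD _ _ _) (lerD step1 _))//.
  exact: le_trans (ler_distD _ _ _) (lerD step2 step3).
rewrite addrCA addrC lerD2r; apply: le_trans eps_le.
by rewrite -[k.+1%:R]natr1 mulrDl mul1r addrC.
Qed.

End decoupling.

(** * Uniform constants, choice of the mesh, and conclusion *)

Lemma finite_lower_bound {R : realType} (J : finType) (g : J -> R) :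
  (forall j, 0 < g j) -> exists2 c, 0 < c & forall j, c <= g j.
Proof.
move=> g0; have h : 0 <= \sum_j (g j)^-1.
  by apply: sumr_ge0 => j _; rewrite invr_ge0 ltW.
(* An explicit substitute for the minimum, meaningful also when [J] is empty. *)
exists (1 + \sum_j (g j)^-1)^-1; first by rewrite invr_gt0 ltr_pwDl.
move=> j; rewrite -[leRHS]invrK lef_pV2 ?posrE ?invr_gt0// ?ltr_pwDl//.
rewrite (bigD1 j)//= addrCA lerDl addr_ge0//.
by apply: sumr_ge0 => i _; rewrite invr_ge0 ltW.
Qed.

Lemma finite_upper_bound {R : realType} (J : finType) (g : J -> R) :
  exists2 c, 0 < c & forall j, g j <= c.
Proof.
exists (1 + \sum_j `|g j|); first by rewrite ltr_pwDl// sumr_ge0.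
move=> j; rewrite (bigD1 j)//= addrCA (le_trans (ler_norm _))// lerDl.
by rewrite addr_ge0// sumr_ge0.
Qed.

Lemma enorm_gt0 {R : realType} {d : nat} (v : 'rV[R]_d) : v != 0 -> 0 < enorm v.
Proof.
move=> v0; rewrite lt_def enorm_ge0 andbT; apply: contra_neq v0 => v0.
apply/rowP => i; rewrite mxE; apply/eqP; rewrite -normr_le0 -v0.
exact: coord_le_enorm.
Qed.

Theorem theorem4p1 (R : realType) (d : nat) (d_ge1 : (1 <= d)%N)
    (D : probability R R) (D_limit : voronoi_limit_law d D)
    (k : nat) (k_ge2 : (2 <= k)%N)
    (dZ : measure_display) (OZ : measurableType dZ) (Q : probability OZ R)
    (Z : 'I_k -> {RV Q >-> R}) (Z_iid : iid Z D)
    (f : 'rV[R]_d -> R) (f_density : prob_density f)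
    (x : 'I_k -> 'rV[R]_d) (x_inj : injective x)
    (x_Lebesgue : forall j, Lebesgue_point f (x j))
    (fx_gt0 : forall j, 0 < f (x j))
    (dX : measure_display) (OX : measurableType dX) (P : probability OX R)
    (X : nat -> {RV P >-> 'rV[R]_d}) (X_iid : iid X (density_measure f)) :
  cvg_in_distribution
    P (fun n w => \row_(j < k) scaled_cell_mass f X (range x) (x j) n w)
    Q (fun w => \row_(j < k) Z j w).
Proof.
have [indX lawX] := X_iid; have [indZ lawZ] := Z_iid.
apply: cvg_in_distribution_rV => [n||phi cphi phi01].
- apply/measurable_fun_rVP => j; under eq_fun do rewrite mxE.
  by apply: measurable_scaled_cell_mass => //; exact: finite_image.
- apply/measurable_fun_rVP => j; under eq_fun do rewrite mxE.
  exact: measurable_funPT.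
have mphi j : measurable_fun setT (phi j) by exact: continuous_measurable_fun.
have bphi d1 (O1 : measurableType d1) (Y : O1 -> R) j : measurable_fun setT Y ->
    bounded_measurable (phi j \o Y).
  move=> mY; apply: bounded_measurable01; last by move=> w; exact: phi01.
  exact: measurableT_comp.
have -> : (fun w => \prod_j phi j ((\row_j Z j w) ord0 j)) =
    (fun w => \prod_j phi j (Z j w)).
  by apply/funext => w; apply: eq_bigr => j _; rewrite mxE.
rewrite (mean_prod_independent indZ (index_enum_uniq _) mphi phi01).
have meanZ j : mean Q (phi j \o Z j) = mean D (phi j).
  rewrite /mean /Rintegral; congr fine.
  rewrite -(ge0_integral_distribution (Z j) (f := EFin \o phi j)).
  - by apply: eq_measure_integral => A mA _; exact: lawZ.
  - exact/measurable_EFinP.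
  - by move=> y; rewrite lee_fin; have /andP[] := phi01 j y.
have cvg1 : \prod_j mean P (phi j \o scaled_cell_mass f X [set x j] (x j) n)
    @[n --> \oo] --> \prod_j mean Q (phi j \o Z j).
  apply: (@cvg_big R) => [|j _]; first exact: mul_continuous.
  rewrite meanZ; have bphi1 : exists M, forall s, `|phi j s| <= M.
    by have [] := bphi _ R id j (@measurable_id _ _ _).
  have mM n : measurable_fun setT (scaled_cell_mass f X [set x j] (x j) n).
    exact: measurable_scaled_cell_mass.
  have := D_limit f (x j) f_density (x_Lebesgue j) (fx_gt0 j) _ _ P X X_iid
    (phi j) (cphi j) bphi1.
  rewrite (expectation_mean D (bphi _ _ _ j (@measurable_id _ _ setT))).
  under eq_cvg => n do rewrite (expectation_mean P (bphi _ _ _ j (mM n))).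
  by move/fine_cvgP => [].
suff dist0 : (fun n => mean P (fun w => \prod_j phi j ((\row_j0
    scaled_cell_mass f X (range x) (x j0) n w) ord0 j)) -
    \prod_j mean P (phi j \o scaled_cell_mass f X [set x j] (x j) n)) @ \oo --> (0 : R).
  rewrite -[X in _ --> X]add0r.
  under eq_cvg => n do rewrite -(subrK (\prod_j mean P (phi j \o
    scaled_cell_mass f X [set x j] (x j) n)) (mean _ _)).
  exact: cvgD.
have /choice[m hm] : forall j, exists m : R * R * R,
    [/\ 0 < m.1.1, 0 < m.1.2, 0 < m.2 & forall e, 0 < e < m.2 ->
      (density_measure f (eball (x j) (grid_radius d e)) <= (m.1.2 * e ^+ d)%:E)%E /\
      (forall a, ((m.1.1 * e ^+ d)%:E <= density_measure f (grid_cell (x j) e a))%E)].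
  move=> j; have [c [C [e0 H]]] :=
    lebesgue_point_masses d_ge1 f_density (x_Lebesgue j) (fx_gt0 j).
  by exists (c, C, e0).
have [c c0 hc] : exists2 c, 0 < c & forall j, c <= (m j).1.1.
  by apply: finite_lower_bound => j; have [] := hm j.
have [C C0 hC] := finite_upper_bound (fun j => (m j).1.2).
have [e1 e10 he1] : exists2 e, 0 < e & forall j, e <= (m j).2.
  by apply: finite_lower_bound => j; have [] := hm j.
(* The value 1 on the diagonal keeps [sep] positive on all pairs, so that it has a positive lower
   bound. *)
pose sep (ij : 'I_k * 'I_k) := if ij.1 == ij.2 then 1 else enorm (x ij.1 - x ij.2).
have [s s0 hs] : exists2 s, 0 < s & forall ij, s <= sep ij.
  apply: finite_lower_bound => -[i j]; rewrite /sep/=.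
  have [_|ij] := eqVneq i j => //; apply: enorm_gt0.
  by rewrite subr_eq0 (inj_eq x_inj).
have d0 : 0 < d%:R :> R by rewrite ltr0n.
have dd0 : 0 < 2 * (16 * d%:R ^+ 2) :> R by rewrite mulr_gt0// mulr_gt0// exprn_gt0.
(* Below [e0] the mass estimates hold at every nucleus, and twice the grid radius is at most the
   separation [s] of the nuclei. *)
pose e0 := Num.min e1 (s / (2 * (16 * d%:R ^+ 2))).
have e00 : 0 < e0 by rewrite lt_min e10 divr_gt0.
apply/cvgrPdist_le => de de0.
pose A : R := (k.+1 * k * #|{ffun 'I_d -> 'I_(8 * d).+1}|)%:R.
have A0 : 0 <= A by [].
(* Chosen so that the locality error [A / (1 + c * K)] is at most [de / 2]; the final [+ 1] makes
   [K] positive. *)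
pose K : R := 2 * A / (de * c) + 1.
have K0 : 0 < K by rewrite ltr_wpDl// divr_ge0// mulr_ge0// ltW.
near=> n.
have n0 : 0 < n%:R :> R by near: n; exact: nbhs_infty_gtr.
have Kn_e0 : K / n%:R < e0 ^+ d.
  rewrite ltr_pdivrMr// mulrC -ltr_pdivrMr ?exprn_gt0//.
  by near: n; exact: nbhs_infty_gtr.
(* With [K] fixed, this makes the covariance error [k^2 C^2 K^2 / n] at most [de / 2]. *)
have n_big : 2 * k%:R ^+ 2 * C ^+ 2 * K ^+ 2 / de <= n%:R.
  by near: n; exact: nbhs_infty_ger.
pose e := (K / n%:R) `^ d%:R^-1.
have e_gt0 : 0 < e by rewrite powR_gt0// divr_gt0.
have ed : e ^+ d = K / n%:R.
  rewrite -powR_mulrn ?ltW// -powRrM mulVf ?gt_eqF// powRr1// ltW// divr_gt0//.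
have e_lt : e < e0 by rewrite -(ltr_pXn2r d_ge1) ?nnegrE ?ltW// ed.
have e_m j : 0 < e < (m j).2.
  by rewrite e_gt0 (lt_le_trans e_lt)// ge_min he1.
have lawE i B : measurable B -> P (X i @^-1` B) = density_measure f B by exact: lawX.
have fineP i B : measurable B -> (fine (P (X i @^-1` B)))%:E = density_measure f B.
  move=> mB; rewrite fineK ?lawE// -(lawX i)//; exact: fin_num_measure.
have x_sep i j : i != j -> 2 * grid_radius d e <= enorm (x i - x j).
  move=> ij; have := hs (i, j); rewrite /sep/= (negbTE ij); apply: le_trans.
  rewrite /grid_radius mulrA mulrC -ler_pdivlMr//.
  by rewrite (le_trans (ltW e_lt))// ge_min lexx orbT.
have ball_le i j : fine (P (X i @^-1` eball (x j) (grid_radius d e))) <= C * (K / n%:R).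
  rewrite -lee_fin fineP; last exact: measurable_eball.
  have [_ _ _ /(_ e (e_m j))[h _]] := hm j.
  by apply: le_trans h _; rewrite lee_fin ed ler_wpM2r// divr_ge0// ltW.
have cell_ge i j a : c * (K / n%:R) <= fine (P (X i @^-1` grid_cell (x j) e a)).
  rewrite -lee_fin fineP; last exact: measurable_grid_cell.
  have [_ _ _ /(_ e (e_m j))[_ h]] := hm j.
  by apply: le_trans (h a); rewrite lee_fin ed ler_wpM2r// divr_ge0// ltW.
rewrite sub0r normrN.
have -> : (fun w => \prod_j phi j ((\row_j0
    scaled_cell_mass f X (range x) (x j0) n w) ord0 j)) =
    (fun w => \prod_j phi j (scaled_cell_mass f X (range x) (x j) n w)).
  by apply/funext => w; apply: eq_bigr => j _; rewrite mxE.
apply: le_trans (scaled_cell_mass_decoupling (n := n) d_ge1 indX f_density e_gt0 x_sep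
  ball_le cell_ge mphi phi01) _.
have q01 : 0 <= c * (K / n%:R) <= 1.
  apply/andP; split; first by rewrite mulr_ge0 ?divr_ge0// ltW.
  (* The quantity is at most 1 because it bounds a probability from below; any sample index, nucleus
     and grid cell can serve. *)
  apply: le_trans (cell_ge 0%N (Ordinal (ltnW k_ge2)) [ffun=> ord0]) _.
  rewrite -lee_fin fineK ?probability_le1// ?fin_num_measure//.
    apply: measurable_funPTI.
    exact: measurable_grid_cell.
  apply: measurable_funPTI.
  exact: measurable_grid_cell.
rewrite -/A [leRHS]splitr lerD//.
  apply: le_trans (ler_wpM2l A0 (expr_onem_le n q01)) _.
  rewrite (_ : n%:R * _ = c * K); last by field; rewrite gt_eqF.
  have cK0 : 0 < 1 + c * K by rewrite addr_gt0// mulr_gt0.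
  rewrite ler_pdivrMr//.
  rewrite (_ : de / 2 * (1 + c * K) = A + de / 2 * (1 + c)); last first.
    by rewrite /K; field; rewrite !gt_eqF.
  by rewrite lerDl mulr_ge0 ?divr_ge0 ?addr_ge0// ltW.
rewrite (_ : n%:R * k%:R ^+ 2 * (C * (K / n%:R)) ^+ 2 =
  k%:R ^+ 2 * C ^+ 2 * K ^+ 2 / n%:R); last by field; rewrite gt_eqF.
rewrite ler_pdivrMr//.
move: n_big; rewrite ler_pdivrMr// => n_big.
rewrite -!mulrA in n_big *; move: n_big.
move: (k%:R ^+ 2 * (C ^+ 2 * K ^+ 2)) (n%:R : R) => B l n_big; lra.
Unshelve. all: by end_near. Qed.
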